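(* For any $\epsilon\in(0,1)$ there exists $P(\epsilon)\in\mathbb{N}$ such that the following holds. Fix any integer $p\ge P(\epsilon)$, and let $\mathcal{S}(\epsilon)=\{\boldsymbol{\sigma}\in\Sigma_n: H(\boldsymbol{\sigma})\ge(1-\epsilon)\sqrt{2\ln 2}\}$, where $H$ is the Ising pure $p$-spin Hamiltonian on $\Sigma_n=\{-1,1\}^n$. Then, as $n\to\infty$, $$\mathbb{E}\left[|\mathcal{S}(\epsilon)|^2\right]=\mathbb{E}\bigl[|\mathcal{S}(\epsilon)|\bigr]^2\bigl(1+o_n(1)\bigr).$$
   Context: For $n\in\mathbb{N}$, $\Sigma_n=\{-1,1\}^n$. For a fixed integer $p\ge 2$, the Ising pure $p$-spin Hamiltonian is $$H(\boldsymbol{\sigma})=H_{n,p}(\boldsymbol{\sigma})=n^{-\frac{p+1}{2}}\sum_{1\le i_1,\dots,i_p\le n}J_{i_1,\dots,i_p}\boldsymbol{\sigma}_{i_1}\cdots\boldsymbol{\sigma}_{i_p},\qquad \boldsymbol{\sigma}\in\Sigma_n,$$ where $\boldsymbol{J}=(J_{i_1,\dots,i_p})_{1\le i_1,\dots,i_p\le n}$ has i.i.d. standard normal entries. Expectations are with respect to $\boldsymbol{J}$. $|A|$ denotes the cardinality of a finite set $A$, and $o_n(1)$ denotes a quantity tending to $0$ as $n\to\infty$ with $p,\epsilon$ fixed. *)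

(* Defs.v *)
From HB Require Import structures.
From mathcomp Require Import all_boot all_order all_algebra.
From mathcomp Require Import all_classical all_reals all_analysis.
Set Implicit Arguments.
Unset Strict Implicit.
Unset Printing Implicit Defensive.
Import Order.TTheory GRing.Theory Num.Theory.
Import numFieldNormedType.Exports.
Local Open Scope classical_set_scope.
Local Open Scope ring_scope.

Definition mutually_independent (d : measure_display) (T : measurableType d)
    (R : realType) (P : probability T R) (I : finType)
    (X : I -> {RV P >-> R}) : Prop :=
  forall (B : {set I}) (A : I -> set R),
    (forall i, i \in B -> measurable (A i)) ->
    P (\bigcap_(i in [set` B]) (X i @^-1` A i)) =
    (\prod_(i in B) P (X i @^-1` A i))%E.

(* The laws are compared on measurable sets only: the values of a measure of
   the library on other sets carry no information. *)
Definition iid_standard_normal (d : measure_display) (T : measurableType d)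
    (R : realType) (P : probability T R) (I : finType)
    (X : I -> {RV P >-> R}) : Prop :=
  (forall (i : I) (A : set R), measurable A ->
     distribution P (X i) A = normal_prob 0 1 A) /\
  mutually_independent X.

(* The hypercube {-1, 1}^n, a configuration being encoded by the Boolean vector
   s whose i-th spin is (-1) ^+ s i. *)
Definition Sigma (n : nat) : finType := {ffun 'I_n -> bool}.

Definition spin (R : realType) (n : nat) (s : Sigma n) (i : 'I_n) : R :=
  (-1) ^+ s i.

(* The indices (i_1, ..., i_p), repetitions allowed, are the p-tuples over
   'I_n. *)
Definition hamiltonian (R : realType) (n p : nat)
    (J : p.-tuple 'I_n -> R) (s : Sigma n) : R :=
  n%:R `^ (- (p.+1%:R / 2)) *
  \sum_(i : p.-tuple 'I_n) J i * \prod_(k < p) spin R s (tnth i k).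

Definition superlevel (R : realType) (n p : nat) (eps : R)
    (J : p.-tuple 'I_n -> R) : {set Sigma n} :=
  [set s | (1 - eps) * Num.sqrt (2 * ln 2) <= hamiltonian J s]%SET.

(* Main.v *)
Require Import Defs.
From HB Require Import structures.
From mathcomp Require Import all_boot all_order all_algebra.
From mathcomp Require Import all_classical all_reals all_analysis.
From mathcomp Require Import measurable_realfun.
From mathcomp Require Import ring lra.
Set Implicit Arguments.
Unset Strict Implicit.
Unset Printing Implicit Defensive.
Import Order.TTheory GRing.Theory Num.Theory.
Import numFieldNormedType.Exports.
Local Open Scope classical_set_scope.
Local Open Scope ring_scope.

(** Write [S] for the set of configurations at level [t = (1 - eps) sqrt (2 ln 2)]
or above, and [u = t sqrt n].  For two configurations [s], [s'] with overlap
[r = 1 - 2 k / n], where [k] is their Hamming distance, the pair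
[(H s, H s')] is centred Gaussian with variances [1 / n] and correlation
[rho = r ^ p].  If [g] is the standard Gaussian tail and [q rho u] is the
probability that both coordinates of a standard pair with correlation [rho]
exceed [u], then [E |S| = 2 ^ n g(u)] and
[[
  E |S|^2 / (E |S|)^2 = sum_k 'C(n, k) / 2 ^ n * q (r ^ p) u / g(u) ^ 2.
]]
This sum is at least 1 by convexity, so only an upper bound [1 + K / n] is
needed ([moment_ratio_le]).  Three ranges of [r] are treated.

- If [r ^ 4 <= 1 / n] and [p >= 8], the correlation is at most [1 / n ^ 2],
  so that [u ^ 2 rho] is of order [1 / n], and [q] is at most
  [(1 + O(1/n)) g(u) ^ 2] ([qtail_neg] and [qtail_near]).
- Otherwise [q <= exp (- u ^ 2 / (1 + |r| ^ p))], hence the ratio is at most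
  [C u ^ 2 exp (u ^ 2 |r| ^ p / (1 + |r| ^ p))] ([qtail_far]).  As long as
  [|r| <= R0 < 1], for [p] large this exponent is at most [n r ^ 2 / 16],
  which loses against the binomial weight [exp (- n r ^ 2 / 8)]
  ([bin_hoeffding]).
- If [|r| >= R0], the exponent is at most
  [u ^ 2 / 2 <= n (1 - eps) ln 2], while for [R0] close to 1 the weight is
  at most [2 ^ (- n) exp (eps n ln 2 / 2)] ([bin_entropy]).

The bounds on [q] come from a geometric picture.  The tuples of indices split
into those on which the two products of spins agree and those on which they
differ; the sums over the two families are independent Gaussian variables, so
that [q] is the standard Gaussian measure of the plane of the wedge
[al x - be |y| >= u] with [al ^ 2 = (1 + rho) / 2] and
[be ^ 2 = (1 - rho) / 2].  For [al <= be] the wedge is contained in the one with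
[al = be], which is a rotated quadrant, of measure [g(u) ^ 2].  For [be <= al],
dilating the vertical sections by [al / be] multiplies their measure by at most
[al / be], and again a rotated quadrant appears.

The joint law of two sums over disjoint families is obtained by adding one
variable at a time ([sum_law]), with the invariance of the standard Gaussian
measure of the plane under the orthogonal reflections of the plane
([std_normal_prod_reflection]). *)

(** * Affine changes of variable for the Lebesgue integral *)

Section Affine.
Context {R : realType}.
Local Notation mu := (@lebesgue_measure R).

Let aff (a b : R) (x : measurableTypeR R) : measurableTypeR R := a * x + b.

Let measurable_aff a b : measurable_fun setT (aff a b).
Proof. by apply: measurable_funD => //; apply: measurable_funM. Qed.

Lemma lebesgue_measure_affine (a b : R) (A : set (measurableTypeR R)) :
  a != 0 -> measurable A ->
  (mu A = `|a|%:E * pushforward mu (aff a b) A)%E.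
Proof.
move=> a0 mA.
pose na : {nonneg R} := NngNum (normr_ge0 a).
have := @lebesgue_measure_unique R (mscale na (pushforward mu (aff a b))).
apply => //= _ [[c d]] _ <-.
rewrite /mscale /= /pushforward.
have [agt0|] := ltP 0 a; last rewrite le_eqVlt (negbTE a0) /= => alt0.
  have -> : aff a b @^-1` [set` `]c, d]] = `](c - b) / a, (d - b) / a]%classic.
    apply/seteqP; split => x /=; rewrite !in_itv /= ltr_pdivrMr // ler_pdivlMr //;
      rewrite /aff mulrC ltrBlDr lerBrDr //.
  rewrite !lebesgue_measure_itv /= !lte_fin ltr_pM2r ?invr_gt0 // ltrD2r.
  case: ifP => _; last by rewrite mule0.
  rewrite -!EFinD -EFinM gtr0_norm //; congr EFin; field; exact: a0.
have -> : aff a b @^-1` [set` `]c, d]] = `[(d - b) / a, (c - b) / a[%classic.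
  apply/seteqP; split => x /=; rewrite !in_itv /= ltr_ndivlMr // ler_ndivrMr //;
    rewrite /aff mulrC ltrBlDr lerBrDr andbC //.
rewrite !lebesgue_measure_itv /= !lte_fin ltr_nM2r ?invr_lt0 // ltrD2r.
case: ifP => _; last by rewrite mule0.
rewrite -!EFinD -EFinM ltr0_norm //; congr EFin; field; exact: a0.
Qed.

Lemma lebesgue_integral_affine (a b : R) (f : R -> \bar R) :
  a != 0 -> measurable_fun setT f -> (forall x, 0 <= f x)%E ->
  (\int[mu]_x f x = `|a|%:E * \int[mu]_x f (a * x + b)%R)%E.
Proof.
move=> a0 mf f0.
pose na : {nonneg R} := NngNum (normr_ge0 a).
rewrite (eq_measure_integral (mscale na (pushforward mu (aff a b)))) //=.
  by rewrite ge0_integral_mscale //= ge0_integral_pushforward.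
by move=> A mA _; rewrite (lebesgue_measure_affine b a0 mA).
Qed.
End Affine.

(** * Reflection invariance of the standard Gaussian measure of the plane *)

Section Rotation.
Context {R : realType}.
Local Notation mu := (@lebesgue_measure R).
Local Notation gamma := (@normal_prob R 0 1).
Local Notation R2 := (measurableTypeR R * measurableTypeR R)%type.
Local Notation phi := (@normal_pdf R 0 1).

Lemma std_normal_pdfE (x : R) : phi x = normal_peak 1 * expR (- (x ^+ 2) / 2).
Proof.
by rewrite normal_pdfE ?oner_neq0 // /normal_fun subr0 expr1n.
Qed.

(** The bound by 1 makes [f] integrable, so that the change of density for
    integrable functions applies. *)
Lemma integral_std_normal (f : R -> \bar R) :
  measurable_fun setT f -> (forall x, 0 <= f x <= 1)%E ->
  (\int[gamma]_x f x = \int[mu]_x (f x * (phi x)%:E))%E.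
Proof.
move=> mf f01.
have abs_f x : `|f x|%E = f x.
  by rewrite gee0_abs //; have /andP[] := f01 x.
rewrite -(Radon_Nikodym_change_of_variables (normal_prob_dominates 0 1)) //=.
  apply: ae_eq_integral => //.
  - apply: emeasurable_funM => //; apply: (measurable_int mu).
    apply: Radon_Nikodym_integrable; exact: normal_prob_dominates.
  - apply: emeasurable_funM => //; apply/measurable_EFinP.
    exact: measurable_normal_pdf.
  - apply: ae_eqe_mul2l => /=.
    rewrite Radon_NikodymE //=; first exact: normal_prob_dominates.
    move=> dom; case: cid => /= h [h1 h2 h3].
    apply: integral_ae_eq => //=.
    + by apply/measurable_EFinP; exact: measurable_normal_pdf.
    + by move=> E _ mE; rewrite -h3.
apply/integrableP; split => //.
apply: (@le_lt_trans _ _ (\int[gamma]_x (cst 1%E x))%E); last first.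
  by rewrite integral_cst //= mul1e probability_setT ltry.
apply: ge0_le_integral => //.
- exact: measurableT_comp.
- by move=> x _; rewrite abs_f; have /andP[] := f01 x.
Qed.

Lemma std_normal_prodE (G : set R2) : measurable G ->
  ((gamma \x gamma)%E G =
   \int[mu]_x \int[mu]_y (\1_G (x, y) * (phi x * phi y))%:E)%E.
Proof.
move=> mG; rewrite /product_measure1.
rewrite integral_std_normal; last 2 first.
- exact: measurable_fun_xsection.
- move=> x; rewrite /= measure_ge0 /=; apply: probability_le1.
  exact: measurable_xsection.
apply: eq_integral => x _ /=.
have mGx : measurable (xsection G x) by exact: measurable_xsection.
rewrite {1}/normal_prob integral_mkcond /= muleC -ge0_integralZl //.
- apply: eq_integral => y _; rewrite patchE mem_xsection indicE.
  by case: ifP => _ /=; rewrite ?mul1r ?mul0r ?mule0.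
- apply/(measurable_restrictT _ mGx)/measurable_funTS/measurable_EFinP.
  exact: measurable_normal_pdf.
- by move=> y _; rewrite patchE; case: ifP => _ //; rewrite lee_fin normal_pdf_ge0.
- by rewrite lee_fin normal_pdf_ge0.
Qed.

Lemma measurable_lin2 (a b : R) :
  measurable_fun setT (fun z : R2 => a * z.1 + b * z.2).
Proof. by apply: measurable_funD; apply: measurable_funM. Qed.

(** For [c ^ 2 + s ^ 2 = 1], an orthogonal reflection of the plane. *)
Definition reflection (c s : R) (z : R2) : R2 :=
  (c * z.1 + s * z.2, s * z.1 + - c * z.2).

Lemma measurable_reflection c s : measurable_fun setT (reflection c s).
Proof. by apply/measurable_fun_pair; exact: measurable_lin2. Qed.

(** Fubini and one affine substitution in each variable: first
    [u = c x + s y] at fixed [x], then [v = (x - c u) / s = s x - c y] at fixed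
    [u]; the two Jacobian factors [|s|] cancel. *)
Lemma std_normal_prod_reflection (c s : R) (G : set R2) :
  measurable G -> s != 0 -> c ^+ 2 + s ^+ 2 = 1 ->
  ((gamma \x gamma) (reflection c s @^-1` G) = (gamma \x gamma) G)%E.
Proof.
move=> mG s0 cs1.
have mrG : measurable (reflection c s @^-1` G).
  by rewrite -[X in measurable X]setTI; exact: measurable_reflection.
rewrite (std_normal_prodE mrG) (std_normal_prodE mG).
pose F (x y : R) := ((\1_G (x, y) : R) * (phi x * phi y))%:E.
have F0 x y : (0 <= F x y)%E by rewrite lee_fin !mulr_ge0 ?normal_pdf_ge0.
have mphi : measurable_fun setT phi by exact: measurable_normal_pdf.
have mF : measurable_fun setT (fun z : R2 => F z.1 z.2).
  apply/measurable_EFinP; apply: measurable_funM.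
    rewrite [X in measurable_fun _ X](_ : _ = \1_G); last by apply/funext => -[].
    exact: measurable_indic.
  by apply: measurable_funM; apply: measurableT_comp.
have phiM x y : phi (c * x + s * y) * phi (s * x + - c * y) = phi x * phi y.
  rewrite !std_normal_pdfE [LHS]mulrACA [RHS]mulrACA -!expRD.
  have e : (c * x + s * y) ^+ 2 + (s * x + - c * y) ^+ 2 = x ^+ 2 + y ^+ 2.
    by rewrite -[RHS]mul1r -cs1; ring.
  by rewrite -!mulrDl -!opprD e.
have indic_reflection x y : \1_(reflection c s @^-1` G) (x, y) =
    \1_G (c * x + s * y, s * x + - c * y) :> R.
  by rewrite !indicE; congr (nat_of_bool _)%:R; apply/idP/idP; rewrite !inE.
(* The integrand after the first substitution, with its Jacobian. *)
pose K (x u : R) := (`|s|^-1%:E * F u ((x - c * u) / s)%R)%E.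
have ns0 : `|s| != 0 by rewrite normr_eq0.
have K0 x u : (0 <= K x u)%E by rewrite mule_ge0.
have mK : measurable_fun setT (fun z : R2 => K z.1 z.2).
  apply: emeasurable_funM => //.
  rewrite (_ : (fun _ => _) = (fun z => F z.1 z.2) \o
    (fun z : R2 => (0 * z.1 + 1 * z.2, s^-1 * z.1 + (- (c / s)) * z.2))).
    by apply: measurableT_comp => //; apply/measurable_fun_pair; exact: measurable_lin2.
  by apply/funext => z /=; congr F; field.
transitivity (\int[mu]_x \int[mu]_u K x u)%E.
  apply: eq_integral => x _.
  rewrite [RHS](@lebesgue_integral_affine R s (c * x)) //; last exact: measurable_fun_pair2 mK.
  rewrite -ge0_integralZl //; last first.
    rewrite (_ : (fun _ => _) = (fun z => K z.1 z.2) \o (fun y => (x, s * y + c * x))) //.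
    apply: measurableT_comp => //; apply/measurable_fun_pair => //.
    by apply: measurable_funD => //; apply: measurable_funM.
  apply: eq_integral => y _.
  rewrite /K muleA -EFinM divff // mul1r.
  have -> : (x - c * (s * y + c * x)) / s = s * x + - c * y.
    rewrite -[x in x - _]mul1r -cs1; field; exact: s0.
  have -> : s * y + c * x = c * x + s * y by rewrite addrC.
  rewrite (phiM x y).
  rewrite (indic_reflection x y).
  reflexivity.
transitivity (\int[mu]_u \int[mu]_x K x u)%E.
  apply: (fubini_tonelli (fun z : R2 => K z.1 z.2)) => // z; exact: K0.
apply: eq_integral => u _.
rewrite (@lebesgue_integral_affine R s (c * u)) //; last exact: measurable_fun_pair1 mK.
rewrite -ge0_integralZl //; last first.
  rewrite (_ : (fun _ => _) = (fun z => K z.1 z.2) \o (fun y => (s * y + c * u, u))) //.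
  apply: measurableT_comp => //; apply/measurable_fun_pair => //.
  by apply: measurable_funD => //; apply: measurable_funM.
apply: eq_integral => v _.
rewrite /K muleA -EFinM divff // mul1r.
by have -> : (s * v + c * u - c * u) / s = v by field; exact: s0.
Qed.
End Rotation.

(** * Laws of pairs and sums of Gaussian variables *)

Section JointLaw.
Context {R : realType}.
Local Notation gamma := (@normal_prob R 0 1).
Local Notation R1 := (measurableTypeR R).
Local Notation R2 := (R1 * R1)%type.

(** The dilations of the line and of the plane along the axes. *)
Definition dilation (sigma : R) (x : R1) : R1 := sigma * x.

Lemma measurable_dilation sigma : measurable_fun setT (dilation sigma).
Proof. exact: measurable_funM. Qed.

HB.instance Definition _ sigma := isMeasurableFun.Build _ _ _ _ (dilation sigma)
  (measurable_dilation sigma).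

(** The law of [sigma Z] for a standard normal [Z].  Unlike [normal_prob 0 sigma],
    it is the Dirac mass at 0 for [sigma = 0], as wanted for empty sums. *)
Definition centered_normal (sigma : R) := distribution gamma (dilation sigma).
HB.instance Definition _ (sigma : R) := Probability.on (centered_normal sigma).

Definition dilation2 (sigma tau : R) (z : R2) : R2 := (sigma * z.1, tau * z.2).

Lemma measurable_dilation2 sigma tau : measurable_fun setT (dilation2 sigma tau).
Proof.
by apply/measurable_fun_pair; apply: measurable_funM.
Qed.

Lemma centered_normal_1 E : centered_normal 1 E = gamma E.
Proof.
rewrite /centered_normal /distribution /pushforward; congr (gamma _).
by apply/funext => x; rewrite /preimage /= /dilation mul1r.
Qed.

(** The measure [m] is not assumed to have mass 1: it will be the restriction of
    a probability to an event, whose probability is [k]. *)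
Lemma joint_law d (T : measurableType d) (m : {measure set T -> \bar R})
    (X Y : T -> R1) (k : {nonneg R}) (sigma tau : R) :
  measurable_fun setT X -> measurable_fun setT Y ->
  (forall E F, measurable E -> measurable F ->
    m (X @^-1` E `&` Y @^-1` F) =
    k%:num%:E * (centered_normal sigma E * centered_normal tau F))%E ->
  forall G : set R2, measurable G ->
  (m ((fun w => (X w, Y w)) @^-1` G) =
   k%:num%:E * (gamma \x gamma) (dilation2 sigma tau @^-1` G))%E.
Proof.
move=> mX mY mXY G mG.
have mZ : measurable_fun setT (fun w => (X w, Y w)) by exact/measurable_fun_pair.
pose m1 := mscale k (centered_normal sigma).
have uniqG (m' : {measure set R2 -> \bar R}) :
    (forall E F, measurable E -> measurable F ->
      m' (E `*` F) = m1 E * centered_normal tau F)%E -> (m1 \x centered_normal tau)%E G = m' G.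
  by move=> h; apply: product_measure_unique.
(* Both sides agree with [k * (centered_normal sigma \x centered_normal tau)] on rectangles. *)
transitivity ((m1 \x centered_normal tau)%E G).
  apply/esym.
  apply: (uniqG (pushforward m (fun w => (X w, Y w)))) => //= E F mE mF.
  by rewrite /m1 /mscale /= -muleA -mXY.
have mS : measurable_fun setT (dilation2 sigma tau) by exact: measurable_dilation2.
apply: (uniqG (mscale k (pushforward (gamma \x gamma)%E (dilation2 sigma tau))))
  => //= E F mE mF.
rewrite /m1 /mscale /= -muleA; congr (_ * _)%E.
rewrite /pushforward.
rewrite (_ : dilation2 sigma tau @^-1` (E `*` F) =
  (dilation sigma @^-1` E) `*` (dilation tau @^-1` F)) //.
apply: product_measure1E; rewrite -[X in measurable X]setTI; exact: measurable_dilation.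
Qed.

(** With [tau ^ 2 = sigma ^ 2 + a ^ 2], the form [sigma x + a y] is [tau] times the
    first coordinate of a reflected point. *)
Lemma sum_law d (T : measurableType d) (m : {measure set T -> \bar R})
    (X Y : T -> R1) (k : {nonneg R}) (sigma a : R) :
  measurable_fun setT X -> measurable_fun setT Y -> a != 0 ->
  (forall E F, measurable E -> measurable F ->
    m (X @^-1` E `&` Y @^-1` F) = k%:num%:E * (centered_normal sigma E * gamma F))%E ->
  forall E, measurable E ->
  (m ((fun w => X w + a * Y w)%R @^-1` E) =
   k%:num%:E * centered_normal (Num.sqrt (sigma ^+ 2 + a ^+ 2)) E)%E.
Proof.
move=> mX mY a0 mXY E mE.
pose tau := Num.sqrt (sigma ^+ 2 + a ^+ 2).
have sa_gt0 : 0 < sigma ^+ 2 + a ^+ 2.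
  by rewrite ltr_wpDl ?sqr_ge0 // exprn_even_gt0.
have tau0 : tau != 0 by rewrite gt_eqF // sqrtr_gt0.
have tau2 : tau ^+ 2 = sigma ^+ 2 + a ^+ 2 by rewrite sqr_sqrtr // ltW.
pose G : set R2 := (fun z : R2 => 1 * z.1 + a * z.2) @^-1` E.
have mG : measurable G.
  by rewrite -[X in measurable X]setTI; exact: measurable_lin2.
have -> : (fun w => X w + a * Y w) @^-1` E = (fun w => (X w, Y w)) @^-1` G.
  by apply/seteqP; split => w; rewrite /G /preimage /= mul1r.
rewrite (@joint_law _ _ m X Y k sigma 1) //; last first.
  by move=> E' F' mE' mF'; rewrite centered_normal_1; exact: mXY.
congr (_ * _)%E.
have -> : dilation2 sigma 1 @^-1` G =
    reflection (sigma / tau) (a / tau) @^-1` ((dilation tau @^-1` E) `*` setT).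
  apply/seteqP; split => z; rewrite /G /preimage /reflection /dilation2 /dilation /=.
    move=> h; split => //; move: h; congr E; field; exact: tau0.
  move=> [h _]; move: h; congr E; field; exact: tau0.
have mtE : measurable (dilation tau @^-1` E).
  by rewrite -[X in measurable X]setTI; exact: measurable_dilation.
rewrite std_normal_prod_reflection.
- by rewrite product_measure1E // [X in (_ * X)%E]probability_setT mule1.
- exact: measurableX.
- by rewrite mulf_neq0 // invr_neq0.
- by rewrite !expr_div_n -mulrDl -tau2 divff // expf_neq0.
Qed.
End JointLaw.

(** * Linear forms in independent standard normal variables *)

Section LinearForms.
Context {R : realType} {d : measure_display} {T : measurableType d}.
Variables (P : probability T R) (I : finType) (J : I -> {RV P >-> R}).
Hypothesis iidJ : iid_standard_normal J.
Variable a : I -> R.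
Hypothesis a_neq0 : forall i, a i != 0.
Local Notation gamma := (@normal_prob R 0 1).
Local Notation R1 := (measurableTypeR R).
Local Notation R2 := (R1 * R1)%type.

(** [X], [Y] and the variables [J i], [i] in [B], are independent, with
    centred normal laws of standard deviations [sigma], [tau] and 1. *)
Let gauss_indep (X Y : T -> R1) (sigma tau : R) (B : {set I}) :=
  forall (A : I -> set R) (E F : set R1), (forall i, measurable (A i)) ->
    measurable E -> measurable F ->
    (P (X @^-1` E `&` Y @^-1` F `&` \bigcap_(i in [set` B]) (J i @^-1` A i)) =
     centered_normal sigma E * centered_normal tau F * \prod_(i in B) gamma (A i))%E.

Let gauss_indepC X Y sigma tau B :
  gauss_indep X Y sigma tau B -> gauss_indep Y X tau sigma B.
Proof.
by move=> h A E F mA mE mF; rewrite [Y @^-1` _ `&` _]setIC h // [(_ tau _ * _)%E]muleC.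
Qed.

Let measurable_bigcapJ (A : I -> set R) (B : {set I}) :
  (forall i, measurable (A i)) ->
  measurable (\bigcap_(i in [set` B]) (J i @^-1` A i)).
Proof.
move=> mA; apply: fin_bigcap_measurable => // i _.
by rewrite -[X in measurable X]setTI; exact: measurable_funP.
Qed.

(** The variable [J j] is moved from the independent remainder into [X]. *)
Let gauss_indep_add X Y sigma tau (B : {set I}) j : j \notin B ->
  measurable_fun setT X -> measurable_fun setT Y ->
  gauss_indep X Y sigma tau (j |: B) ->
  gauss_indep (fun w => X w + a j * J j w) Y
    (Num.sqrt (sigma ^+ 2 + a j ^+ 2)) tau B.
Proof.
move=> jB mX mY h A E F mA mE mF.
(* [sum_law] is applied to [P] restricted to the event [D] on the other variables. *)
pose D := Y @^-1` F `&` \bigcap_(i in [set` B]) (J i @^-1` A i).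
have mD : measurable D.
  apply: measurableI; last exact: measurable_bigcapJ.
  by rewrite -[X in measurable X]setTI; exact: mY.
pose c := (centered_normal tau F * \prod_(i in B) gamma (A i))%E.
have c0 : (0 <= c)%E by rewrite mule_ge0 // prode_ge0.
have cfin : c \is a fin_num.
  apply: fin_numM; first exact: fin_num_measure.
  apply: prode_fin_num => i _. exact: (fin_num_measure gamma _ (mA i)).
pose k : {nonneg R} := NngNum (fine_ge0 c0).
have kE : k%:num%:E = c by rewrite /= fineK.
rewrite -setIA -/D -muleA -/c [RHS]muleC -kE.
have mJ i : measurable_fun setT (J i) by exact: measurable_funP.
apply: (@sum_law R d T (mrestr P mD) X (J j) k sigma (a j) mX (mJ j)) => // E' F' mE' mF'.
rewrite kE /mrestr.
pose A' i := if i == j then F' else A i.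
have mA' i : measurable (A' i).
  by rewrite /A'; case: eqP => _; [exact mF'|exact (mA i)].
have := h A' E' F mA' mE' mF.
have -> : \bigcap_(i in [set` j |: B]) (J i @^-1` A' i) =
    J j @^-1` F' `&` \bigcap_(i in [set` B]) (J i @^-1` A i).
  apply/seteqP; split => w /=.
    move=> hw; split; first by have := hw j; rewrite /A' /= eqxx; apply; rewrite !inE eqxx.
    move=> i /= iB; have := hw i; rewrite /A' /= !inE iB orbT => /(_ isT).
    by case: eqP => // ij; move: jB; rewrite -ij iB.
  move=> [hj hB] i /=; rewrite !inE /A'; case: eqP => [-> //|_] /= iB.
  exact: hB.
rewrite big_setU1 //= {1}/A' eqxx.
rewrite (eq_bigr (fun i => gamma (A i))); last first.
  by move=> i iB; rewrite /A'; case: eqP => // ij; move: jB; rewrite -ij iB.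
move=> hh.
transitivity (P (X @^-1` E' `&` Y @^-1` F `&`
    (J j @^-1` F' `&` \bigcap_(i in [set` B]) (J i @^-1` A i)))).
  by congr (P _); rewrite /D !setIA; congr (_ `&` _); rewrite -!setIA;
    congr (_ `&` _); rewrite setIC.
by rewrite hh /c [RHS]muleC; exact: muleACA.
Qed.

(** The linear form with coefficients [a] restricted to the indices in [s]. *)
Definition linear_form (s : seq I) (w : T) : R := \sum_(i <- s) a i * J i w.

(** The standard deviation of [linear_form s] when [s] has no repetition. *)
Definition form_sd (s : seq I) : R := Num.sqrt (\sum_(i <- s) a i ^+ 2).

Lemma measurable_linear_form s : measurable_fun setT (linear_form s).
Proof.
by apply: measurable_sum => i; apply: measurable_funM.
Qed.

Let gauss_indep_forms (s1 s2 : seq I) (B : {set I}) :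
  uniq (s1 ++ s2) -> {in s1 ++ s2, forall i, i \notin B} ->
  gauss_indep (linear_form s1) (linear_form s2) (form_sd s1) (form_sd s2) B.
Proof.
have linear_form_cons j s : linear_form (j :: s) = (fun w => linear_form s w + a j * J j w).
  by apply/funext => w; rewrite /linear_form big_cons addrC.
have form_sd_cons j s : form_sd (j :: s) = Num.sqrt (form_sd s ^+ 2 + a j ^+ 2).
  rewrite /form_sd big_cons addrC sqr_sqrtr //.
  by apply: sumr_ge0 => i _; exact: sqr_ge0.
have notinU (j : I) (s : seq I) (B' : {set I}) : j \notin s -> {in j :: s, forall i, i \notin B'} ->
    {in s, forall i : I, i \notin (j |: B')}.
  move=> js h i si; rewrite !inE negb_or h ?andbT; last by rewrite inE si orbT.
  by apply: contraNneq js => <-.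
elim: s1 B => [|j s1 IH] B /=; last first.
  move=> /andP[js us] hB; rewrite linear_form_cons form_sd_cons.
  apply: gauss_indep_add; [by apply: hB; rewrite inE eqxx|exact: measurable_linear_form..|].
  by apply: IH => //; exact: notinU.
elim: s2 B => [|j s2 IH] B /=; last first.
  move=> /andP[js us] hB; rewrite linear_form_cons form_sd_cons.
  apply: gauss_indepC; apply: gauss_indep_add;
    [by apply: hB; rewrite inE eqxx|exact: measurable_linear_form..|].
  by apply: gauss_indepC; apply: IH => //; exact: notinU.
(* Both forms are empty sums: their law is the Dirac mass at 0. *)
move=> _ _ A E F mA mE mF.
have -> : (\prod_(i in B) gamma (A i) =
    P (\bigcap_(i in [set` B]) (J i @^-1` A i)))%E.
  have [lawJ indJ] := iidJ.
  rewrite indJ //; apply: eq_bigr => i _; exact/esym/lawJ.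
have sd0 : form_sd [::] = 0 by rewrite /form_sd big_nil sqrtr0.
have preT (G : set R1) : 0 \in G -> linear_form [::] @^-1` G = setT.
  move=> /set_mem G0; apply/seteqP; split => w //= _.
  by rewrite /linear_form /preimage /= big_nil.
have pre0 (G : set R1) : 0 \notin G -> linear_form [::] @^-1` G = set0.
  move=> /negP G0; apply/seteqP; split => w //=.
  rewrite /linear_form /preimage /= big_nil => h; apply: G0; exact/mem_set.
have nT (G : set R1) : 0 \in G -> centered_normal 0 G = 1%E.
  move=> /set_mem G0; rewrite /centered_normal /distribution /pushforward.
  rewrite (_ : _ @^-1` _ = setT) ?probability_setT //.
  by apply/seteqP; split => w //= _; rewrite /preimage /= /dilation mul0r.
have n0 (G : set R1) : 0 \notin G -> centered_normal 0 G = 0%E.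
  move=> /negP G0; rewrite /centered_normal /distribution /pushforward.
  rewrite (_ : _ @^-1` _ = set0) ?measure0 //.
  apply/seteqP; split => w //=; rewrite /preimage /= /dilation mul0r => h.
  by apply: G0; exact/mem_set.
rewrite sd0; case: (boolP (0 \in E)) => hE; last first.
  by rewrite (pre0 E) // (n0 E) // !mul0e !set0I measure0.
case: (boolP (0 \in F)) => hF; last first.
  by rewrite (pre0 F) // (n0 F) // mule0 mul0e setI0 !set0I measure0.
by rewrite !preT // !nT // !setTI !mul1e.
Qed.

Lemma linear_forms_joint_law (s1 s2 : seq I) (G : set R2) :
  uniq (s1 ++ s2) -> measurable G ->
  (P ((fun w => (linear_form s1 w, linear_form s2 w)) @^-1` G) =
   (gamma \x gamma) (dilation2 (form_sd s1) (form_sd s2) @^-1` G))%E.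
Proof.
move=> us mG.
rewrite (@joint_law R d T P (linear_form s1) (linear_form s2) (NngNum ler01)
  (form_sd s1) (form_sd s2)) ?mul1e //; try exact: measurable_linear_form.
move=> E F mE mF; rewrite mul1e.
have h : {in s1 ++ s2, forall i, i \notin (finset.set0 : {set I})}.
  by move=> i _; rewrite inE.
have := gauss_indep_forms us h (A := fun=> setT) (fun _ => measurableT) mE mF.
rewrite big_set0 mule1 => <-; congr (P _).
apply/seteqP; split => w //=; last by case.
Qed.
End LinearForms.

(** * Estimates of the Gaussian tail *)

Section GaussTail.
Context {R : realType}.
Local Notation mu := (@lebesgue_measure R).
Local Notation gamma := (@normal_prob R 0 1).
Local Notation phi := (@normal_pdf R 0 1).
Local Notation R1 := (measurableTypeR R).
Local Notation R2 := (R1 * R1)%type.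

(** The probability that a standard normal variable is at least [u]. *)
Definition gtail (u : R) : R := fine (gamma `[u, +oo[%classic).

Lemma gtailE u : (gtail u)%:E = gamma `[u, +oo[%classic.
Proof. by rewrite /gtail fineK // fin_num_measure. Qed.

Lemma gtail_ge0 u : 0 <= gtail u.
Proof. by rewrite -lee_fin gtailE. Qed.

Lemma std_normal_pdf_le (x y : R) : 0 <= x -> x <= y -> phi y <= phi x.
Proof.
move=> x0 xy; rewrite !std_normal_pdfE ler_wpM2l ?normal_peak_ge0 // ler_expR.
by rewrite ler_pM2r ?invr_gt0 // lerN2 ler_sqr ?nnegrE // (le_trans x0).
Qed.

Let measurable_phi (A : set R1) : measurable_fun A (fun x => (phi x)%:E).
Proof. by apply: measurable_funTS; apply/measurable_EFinP; exact: measurable_normal_pdf. Qed.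

Lemma normal_itv_ge (a b : R) : 0 <= a -> a <= b ->
  (((b - a) * phi b)%:E <= gamma `[a, b]%classic)%E.
Proof.
move=> a0 ab; rewrite /normal_prob.
apply: (@le_trans _ _ (\int[mu]_(x in `[a, b]) (phi b)%:E)%E).
  by rewrite integral_cst //= lebesgue_measure_itv /= lte_fin; case: ltP => ab';
   [rewrite -EFinD -EFinM mulrC|rewrite mule0 lee_fin; have -> : b = a by apply/eqP; rewrite eq_le ab' ab]; rewrite ?subrr ?mul0r.
apply: ge0_le_integral => //=.
- by move=> x _; rewrite lee_fin normal_pdf_ge0.
- move=> x; rewrite in_itv /= => /andP[ax xb].
  by rewrite lee_fin std_normal_pdf_le // (le_trans a0).
Qed.

Lemma normal_itv_le (a b : R) : 0 <= a -> a <= b ->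
  (gamma `[a, b[%classic <= ((b - a) * phi a)%:E)%E.
Proof.
move=> a0 ab; rewrite /normal_prob.
apply: (@le_trans _ _ (\int[mu]_(x in `[a, b[) (phi a)%:E)%E); last first.
  by rewrite integral_cst //= lebesgue_measure_itv /= lte_fin; case: ltP => ab';
   [rewrite -EFinD -EFinM mulrC|rewrite mule0 lee_fin; have -> : b = a by apply/eqP; rewrite eq_le ab' ab]; rewrite ?subrr ?mul0r.
apply: ge0_le_integral => //=.
- by move=> x _; rewrite lee_fin normal_pdf_ge0.
- move=> x; rewrite in_itv /= => /andP[ax xb].
  by rewrite lee_fin std_normal_pdf_le.
Qed.

Lemma gtail_ge (u h : R) : 0 <= u -> 0 <= h -> h * phi (u + h) <= gtail u.
Proof.
move=> u0 h0; rewrite -lee_fin gtailE.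
have uuh : u <= u + h by rewrite lerDl.
have := normal_itv_ge u0 uuh; rewrite [u + h - u]addrAC subrr add0r => /le_trans; apply.
by apply: le_measure; rewrite ?inE //=; apply: subset_itvl; rewrite bnd_simp.
Qed.

Lemma gtail_gt0 (u : R) : 0 <= u -> 0 < gtail u.
Proof.
move=> u0; apply: lt_le_trans (gtail_ge u0 ler01).
by rewrite mul1r std_normal_pdfE mulr_gt0 ?expR_gt0 // normal_peak_gt0 ?oner_neq0.
Qed.

Lemma gtail_sub_le (v u : R) : 0 <= v -> v <= u ->
  gtail v <= gtail u + (u - v) * phi v.
Proof.
move=> v0 vu; rewrite -lee_fin EFinD !gtailE.
rewrite (_ : `[v, +oo[%classic = `[v, u[%classic `|` `[u, +oo[%classic); last first.
  by rewrite -itv_bndbnd_setU // bnd_simp.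
apply: le_trans (measureU2 _ _ _) _ => //.
by rewrite addeC; apply: leeD => //; exact: normal_itv_le.
Qed.

Lemma gtail_chernoff (u : R) : 0 <= u -> gtail u <= expR (- u ^+ 2 / 2).
Proof.
move=> u0; rewrite -lee_fin gtailE /normal_prob integral_mkcond /=.
have mr (A : set R1) : measurable A -> measurable_fun setT ((fun x => (phi x)%:E) \_ A).
  by move=> mA; apply/(measurable_restrictT _ mA); exact: measurable_phi.
have r0 (A : set R1) x : (0 <= ((fun x => (phi x)%:E) \_ A) x)%E.
  by rewrite patchE; case: ifP => // _; rewrite lee_fin normal_pdf_ge0.
rewrite (@lebesgue_integral_affine R 1 u) ?oner_neq0 //; last exact: mr.
rewrite normr1 mul1e.
apply: (@le_trans _ _ (\int[mu]_x ((expR (- u ^+ 2 / 2))%:E * (phi x)%:E))%E).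
  apply: ge0_le_integral => //.
  - apply: measurableT_comp; first exact: mr.
    by apply: measurable_funD => //; apply: measurable_funM.
  - by apply: emeasurable_funM => //; exact: measurable_phi.
  - move=> x _; rewrite patchE; case: ifP; last first.
      by rewrite -EFinM lee_fin mulr_ge0 ?expR_ge0 // normal_pdf_ge0.
    rewrite inE /= in_itv /= andbT mul1r lerDr => x0.
    rewrite -EFinM lee_fin !std_normal_pdfE mulrCA ler_wpM2l ?normal_peak_ge0 //.
    rewrite -expRD ler_expR -mulrDl ler_pM2r ?invr_gt0 //.
    rewrite -opprD lerN2; have := mulr_ge0 u0 x0; nra.
rewrite ge0_integralZl //.
- by rewrite integral_normal_pdf mule1.
- by move=> x _; rewrite lee_fin normal_pdf_ge0.
Qed.

(** The density decreases away from 0, so dilating a centred interval by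
    [l >= 1] multiplies its measure by at most [l]. *)
Lemma normal_sym_dilation (l w : R) : 1 <= l -> 0 <= w ->
  (gamma `[(- (l * w))%R, (l * w)%R]%classic <= l%:E * gamma `[(- w)%R, w]%classic)%E.
Proof.
move=> l1 w0; have l0 : 0 < l by exact: lt_le_trans l1.
rewrite /normal_prob [leLHS]integral_mkcond [X in (_ * X)%E]integral_mkcond /=.
have mr (A : set R1) : measurable A -> measurable_fun setT ((fun x => (phi x)%:E) \_ A).
  by move=> mA; apply/(measurable_restrictT _ mA); exact: measurable_phi.
have r0 (A : set R1) x : (0 <= ((fun x => (phi x)%:E) \_ A) x)%E.
  by rewrite patchE; case: ifP => // _; rewrite lee_fin normal_pdf_ge0.
rewrite (@lebesgue_integral_affine R l 0) ?gt_eqF //; last exact: mr.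
rewrite gtr0_norm // lee_wpmul2l ?lee_fin ?(ltW l0) //.
apply: ge0_le_integral => //.
- apply: measurableT_comp; first exact: mr.
  by apply: measurable_funD => //; apply: measurable_funM.
- exact: mr.
- move=> x _; rewrite !patchE addr0 !mem_setE !in_itv /=.
  rewrite -mulrN !ler_pM2l //; case: ifP => // _.
  rewrite lee_fin !std_normal_pdfE ler_wpM2l ?normal_peak_ge0 // ler_expR.
  rewrite ler_pM2r ?invr_gt0 // lerN2 exprMn ler_peMl ?sqr_ge0 //.
  by rewrite exprn_ege1.
Qed.

End GaussTail.

(** * The Gaussian measure of a wedge *)

Section JointTail.
Context {R : realType}.
Local Notation gamma := (@normal_prob R 0 1).
Local Notation R1 := (measurableTypeR R).
Local Notation R2 := (R1 * R1)%type.

(** For [be >= 0], the wedge [u <= al x - be |y|]. *)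
Definition wedge (al be u : R) : set R2 :=
  [set z | u <= al * z.1 + be * z.2 /\ u <= al * z.1 - be * z.2].

Lemma measurable_wedge al be u : measurable (wedge al be u).
Proof.
rewrite (_ : wedge al be u =
  (fun z : R2 => al * z.1 + be * z.2) @^-1` `[u, +oo[ `&`
  (fun z : R2 => al * z.1 + (- be) * z.2) @^-1` `[u, +oo[).
  by apply: measurableI; rewrite -[X in measurable X]setTI; apply: measurable_lin2.
by apply/seteqP; split => z; rewrite /wedge /= !in_itv /= !andbT mulNr.
Qed.

(** The standard Gaussian measure of the wedge. *)
Definition joint_tail (al be u : R) : R := fine ((gamma \x gamma)%E (wedge al be u)).

Lemma joint_tailE al be u :
  (joint_tail al be u)%:E = (gamma \x gamma)%E (wedge al be u).
Proof.
rewrite /joint_tail fineK // ge0_fin_numE ?measure_ge0 //.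
apply: (@le_lt_trans _ _ ((gamma \x gamma)%E (setT `*` setT))).
  by apply: le_measure; rewrite ?inE; [exact: measurable_wedge|exact: measurableX|].
rewrite product_measure1E // [X in (_ * X)%E]probability_setT mule1.
by rewrite [X in (X < _)%E]probability_setT ltry.
Qed.

(** For [al = be] the wedge is a quadrant rotated by 45 degrees. *)
Lemma joint_tail_diag (r u : R) : 0 < r ->
  joint_tail r r u = gtail (u / (Num.sqrt 2 * r)) ^+ 2.
Proof.
move=> r0; apply: EFin_inj; rewrite joint_tailE.
set v := u / _.
have s2 : 0 < Num.sqrt (2 : R) by rewrite sqrtr_gt0.
have sq2 : Num.sqrt (2 : R) ^+ 2 = 2 by rewrite sqr_sqrtr.
pose c := (Num.sqrt (2 : R))^-1.
have c0 : 0 < c by rewrite invr_gt0.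
have -> : wedge r r u = reflection c c @^-1` (`[v, +oo[%classic `*` `[v, +oo[%classic).
  have e (x : R) : (u <= r * x) = (v <= c * x).
    rewrite /v /c ler_pdivrMr ?mulr_gt0 //; congr (_ <= _); field; exact: lt0r_neq0.
  apply/seteqP; split => z; rewrite /wedge /reflection /= !in_itv /= !andbT;
   by rewrite mulNr -!mulrBr -!mulrDr !e.
rewrite std_normal_prod_reflection ?lt0r_neq0 //.
- by rewrite expr2 EFinM !gtailE; exact: product_measure1E.
- exact: measurableX.
- by rewrite /c exprVn sq2; lra.
Qed.

(** The case of a nonpositive correlation: since [x >= 0] on the wedge, raising
    [al] and lowering [be] to [1 / sqrt 2] enlarges it. *)
Lemma joint_tail_neg (al be u : R) : 0 <= al -> al <= be ->
  al ^+ 2 + be ^+ 2 = 1 -> 0 < u -> joint_tail al be u <= gtail u ^+ 2.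
Proof.
move=> al0 albe ab1 u0.
have s2 : 0 < Num.sqrt (2 : R) by rewrite sqrtr_gt0.
have sq2 : Num.sqrt (2 : R) ^+ 2 = 2 by rewrite sqr_sqrtr.
pose c := (Num.sqrt (2 : R))^-1.
have c0 : 0 < c by rewrite invr_gt0.
have c2 : c ^+ 2 = 1 / 2 by rewrite /c exprVn sq2; lra.
have alc : al <= c by rewrite -(@ler_pXn2r _ 2) ?nnegrE ?(ltW c0) // c2; nra.
have cbe : c <= be by rewrite -(@ler_pXn2r _ 2) ?nnegrE ?(ltW c0) ?(le_trans al0) // c2; nra.
have -> : gtail u = gtail (u / (Num.sqrt 2 * c)) by rewrite /c divff ?gt_eqF // divr1.
rewrite -(joint_tail_diag u c0) -lee_fin.
rewrite [leLHS]joint_tailE [leRHS]joint_tailE.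
apply: le_measure; rewrite ?inE; [exact: measurable_wedge..|].
move=> z [h1 h2].
have z1 : 0 <= z.1.
  by rewrite leNgt; apply/negP => zn; nra.
have : al * z.1 <= c * z.1 by exact: ler_wpM2r.
split; have [z2|z2] := leP 0 z.2.
- have := mulr_ge0 (ltW c0) z2; have := mulr_ge0 (le_trans al0 albe) z2; nra.
- have : be * z.2 <= c * z.2 by rewrite ler_nM2r.
  nra.
- have : c * z.2 <= be * z.2 by exact: ler_wpM2r.
  nra.
- have : c * z.2 < 0 by rewrite pmulr_rlt0.
  have : be * z.2 < 0 by rewrite pmulr_rlt0 // (lt_le_trans c0).
  nra.
Qed.

(** The case of a nonnegative correlation: each vertical section is an interval
    of half-length [(al x - u) / be], a dilation by [al / be] of that of the
    wedge with [be = al]. *)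
Lemma joint_tail_pos (al be u : R) : 0 < be -> be <= al ->
  joint_tail al be u <= al / be * gtail (u / (Num.sqrt 2 * al)) ^+ 2.
Proof.
move=> be0 beal; have al0 := lt_le_trans be0 beal.
rewrite -(joint_tail_diag u al0) -lee_fin EFinM.
rewrite [leLHS]joint_tailE [X in (_ * X)%E]joint_tailE.
rewrite /product_measure1 -ge0_integralZl //; first last.
- by rewrite lee_fin divr_ge0 // ltW.
- by apply: measurable_fun_xsection; exact: measurable_wedge.
apply: ge0_le_integral => //.
- by apply: measurable_fun_xsection; exact: measurable_wedge.
- by apply: emeasurable_funM => //; apply: measurable_fun_xsection; exact: measurable_wedge.
move=> x _ /=.
(* The section at [x]; it is empty when [al * x < u]. *)
have sec b : 0 < b -> xsection (wedge al b u) x = `[- ((al * x - u) / b), (al * x - u) / b]%classic.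
  move=> b0; rewrite xsectionE; apply/seteqP; split => y; rewrite /wedge /= in_itv /=.
    move=> [h1 h2]; rewrite lerNl !ler_pdivlMr //; apply/andP; split; nra.
  rewrite lerNl !ler_pdivlMr // => /andP[h1 h2]; split; nra.
rewrite !sec //.
have [w0|w0] := leP 0 (al * x - u); last first.
  rewrite (_ : `[_, _]%classic = set0) ?measure0 ?mule_ge0 ?lee_fin ?divr_ge0 ?(ltW al0) ?(ltW be0) //.
  apply/seteqP; split => y //; rewrite /= in_itv /= => /andP[h1 h2].
  have := le_trans h1 h2; rewrite -mulNr ler_pM2r ?invr_gt0 //; lra.
rewrite (_ : (al * x - u) / be = al / be * ((al * x - u) / al)); last first.
  by field; rewrite !gt_eqF.
apply: normal_sym_dilation; first by rewrite ler_pdivlMr // mul1r.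
by rewrite divr_ge0 // ltW.
Qed.

Lemma joint_tail_le (al be u : R) : 0 < al -> joint_tail al be u <= gtail (u / al).
Proof.
move=> al0; rewrite -lee_fin joint_tailE gtailE.
apply: (@le_trans _ _ ((gamma \x gamma)%E (`[u / al, +oo[%classic `*` setT))).
  apply: le_measure; rewrite ?inE; [exact: measurable_wedge|exact: measurableX|].
  move=> z [h1 h2]; split => //=; rewrite in_itv /= andbT ler_pdivrMr // mulrC; lra.
by rewrite product_measure1E // [X in (_ * X)%E]probability_setT mule1.
Qed.

Lemma joint_tail0 (be u : R) : 0 < u -> joint_tail 0 be u = 0.
Proof.
move=> u0; rewrite /joint_tail (_ : wedge _ _ _ = set0) ?measure0 //.
by apply/seteqP; split => z // [/=]; rewrite mul0r; lra.
Qed.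
End JointTail.

(** * The joint tail as a function of the correlation *)

Section CorrelatedTail.
Context {R : realType}.
Local Notation phi := (@normal_pdf R 0 1).

(** The probability that two standard normal variables of correlation [rho] are
    both at least [u], realized as [al Z + be Z'] and [al Z - be Z'] with
    [al ^ 2 = (1 + rho) / 2] and [be ^ 2 = (1 - rho) / 2]. *)
Definition qtail (rho u : R) : R :=
  joint_tail (Num.sqrt ((1 + rho) / 2)) (Num.sqrt ((1 - rho) / 2)) u.

(** A lower bound on the tail, from the mass of the interval from [u] to [u + 1 / u]. *)
Lemma mills_lower_bound (u : R) : 1 <= u ->
  normal_peak 1 * expR (- u ^+ 2 / 2) <= expR (3 / 2) * u * gtail u.
Proof.
move=> u1; have u0 : 0 < u by exact: lt_le_trans u1.
have iu0 : 0 < u^-1 by rewrite invr_gt0.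
have iu1 : u^-1 <= 1 by rewrite invf_le1.
rewrite -(ler_pM2l iu0) !mulrA.
apply: (@le_trans _ _ (expR (3 / 2) * (u^-1 * phi (u + u^-1)))); last first.
  rewrite -!mulrA [leRHS]mulrCA mulKf ?gt_eqF //.
  by rewrite ler_wpM2l ?expR_ge0 //; apply: gtail_ge; exact: ltW.
rewrite std_normal_pdfE -mulrA [leRHS]mulrCA ler_wpM2l ?(ltW iu0) //.
rewrite [leRHS]mulrCA ler_wpM2l ?normal_peak_ge0 // -expRD ler_expR.
have -> : (u + u^-1) ^+ 2 = u ^+ 2 + 2 + u^-1 ^+ 2.
  by field; exact: lt0r_neq0.
have : u^-1 ^+ 2 <= 1 by rewrite expr_le1 ?(ltW iu0).
lra.
Qed.

Lemma qtail_neg (rho u : R) : -1 <= rho -> rho <= 0 -> 0 < u ->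
  qtail rho u <= gtail u ^+ 2.
Proof.
move=> r1 r0 u0; apply: joint_tail_neg => //.
- by rewrite ler_wsqrtr //; lra.
- by rewrite !sqr_sqrtr; lra.
Qed.

(** Lowering the level from [u] to [u / sqrt (1 + rho)] costs a factor close to 1
    when [u ^ 2 * rho] is small. *)
Lemma gtail_shrink (rho u : R) : 0 <= rho -> 1 <= u ->
  gtail (u / Num.sqrt (1 + rho)) <=
  (1 + u ^+ 2 * rho * expR (u ^+ 2 * rho / 2 + 3 / 2)) * gtail u.
Proof.
move=> r0 u1; have u0 : 0 < u by exact: lt_le_trans u1.
set l := Num.sqrt (1 + rho).
have l2 : l ^+ 2 = 1 + rho by rewrite sqr_sqrtr; lra.
have l0 : 0 < l by rewrite sqrtr_gt0; lra.
have l1 : 1 <= l by rewrite -[leLHS]sqrtr1 ler_wsqrtr //; lra.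
have il : 1 - rho <= l^-1.
  rewrite -[leRHS]mul1r ler_pdivlMr //; nra.
have v0 : 0 <= u / l by rewrite divr_ge0 // ltW.
have vu : u / l <= u by rewrite ler_pdivrMr // ler_peMr // ltW.
apply: le_trans (gtail_sub_le v0 vu) _.
rewrite [leRHS]mulrDl mul1r lerD2l.
have h1 : u - u / l <= u * rho.
  by rewrite -[X in X - _]mulr1 -mulrBr ler_pM2l //; lra.
apply: (@le_trans _ _ (u * rho * (normal_peak 1 * expR (- u ^+ 2 / 2) * expR (u ^+ 2 * rho / 2)))).
  apply: ler_pM => //; [by rewrite subr_ge0|exact: normal_pdf_ge0|].
  rewrite std_normal_pdfE -mulrA ler_wpM2l ?normal_peak_ge0 // -expRD ler_expR.
  rewrite expr_div_n l2 -mulrDl ler_pM2r ?invr_gt0 //.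
  rewrite -lerN2 opprK opprD opprK -[X in X - _]mulr1 -mulrBr.
  rewrite ler_wpM2l ?sqr_ge0 // -[leRHS]mul1r ler_pdivlMr; nra.
rewrite expRD.
have h := mills_lower_bound u1.
have e0 := expR_ge0 (u ^+ 2 * rho / 2).
have ur0 : 0 <= u * rho by rewrite mulr_ge0 // ltW.
have := ler_wpM2l (mulr_ge0 ur0 e0) h.
by congr (_ <= _); ring.
Qed.

Lemma qtail_near (rho u : R) : 0 <= rho -> rho <= 1 / 2 -> 1 <= u ->
  qtail rho u <= (1 + 4 * rho) *
    ((1 + u ^+ 2 * rho * expR (u ^+ 2 * rho / 2 + 3 / 2)) * gtail u) ^+ 2.
Proof.
move=> r0 r12 u1; rewrite /qtail.
set al := Num.sqrt _; set be := Num.sqrt ((1 - _) / _).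
have be0 : 0 < be by rewrite sqrtr_gt0; lra.
have beal : be <= al by rewrite ler_wsqrtr //; lra.
have al0 : 0 < al by exact: lt_le_trans beal.
apply: le_trans (joint_tail_pos u be0 beal) _.
have -> : Num.sqrt 2 * al = Num.sqrt (1 + rho).
  by rewrite -sqrtrM //; congr Num.sqrt; field.
apply: ler_pM.
- by rewrite divr_ge0 // ltW.
- by rewrite sqr_ge0.
- rewrite ler_pdivrMr //.
  have al2 : al ^+ 2 = (1 + rho) / 2 by rewrite sqr_sqrtr; lra.
  have be2 : be ^+ 2 = (1 - rho) / 2 by rewrite sqr_sqrtr; lra.
  have c0 : 0 <= (1 + 4 * rho) * be by rewrite mulr_ge0 ?(ltW be0) //; lra.
  rewrite -(@ler_pXn2r _ 2) ?nnegrE ?(ltW al0) // exprMn al2 be2; nra.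
- rewrite lerXn2r ?nnegrE ?gtail_ge0 //; last exact: gtail_shrink.
  by apply: le_trans (gtail_ge0 _) (gtail_shrink r0 u1).
Qed.

(** A bound without loss of exponential order, valid for all correlations up to
    [r]; it only uses that one coordinate is large on the wedge. *)
Lemma qtail_far (rho r u : R) : -1 <= rho -> rho <= r -> 0 <= r -> 1 <= u ->
  qtail rho u <= expR 3 / normal_peak 1 ^+ 2 * u ^+ 2 *
    expR (u ^+ 2 * r / (1 + r)) * gtail u ^+ 2.
Proof.
move=> r1 rr r0 u1; have u0 : 0 < u by exact: lt_le_trans u1.
have pk : 0 < @normal_peak R 1 by rewrite normal_peak_gt0 ?oner_neq0.
have [rm1|rgt] := leP rho (-1).
  have -> : rho = -1 by apply/eqP; rewrite eq_le rm1 r1.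
  rewrite /qtail subrr mul0r sqrtr0 joint_tail0 //.
  by rewrite !mulr_ge0 ?invr_ge0 ?sqr_ge0 ?expR_ge0 ?gtail_ge0 ?(ltW u0) ?(ltW pk).
rewrite /qtail; set al := Num.sqrt _.
have al0 : 0 < al by rewrite sqrtr_gt0; lra.
have al2 : al ^+ 2 = (1 + rho) / 2 by rewrite sqr_sqrtr; lra.
apply: le_trans (joint_tail_le _ _ al0) _.
apply: le_trans (gtail_chernoff _) _; first by rewrite divr_ge0 // ltW.
apply: (@le_trans _ _ (expR (- (u ^+ 2 / (1 + r))))).
  have -> : - (u / al) ^+ 2 / 2 = - (u ^+ 2 / (1 + rho)).
    by rewrite expr_div_n al2; field; lra.
  rewrite ler_expR lerN2 ler_wpM2l ?sqr_ge0 // lef_pV2 ?posrE; lra.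
have h := mills_lower_bound u1.
have h2 : (normal_peak 1 * expR (- u ^+ 2 / 2)) ^+ 2 <= (expR (3 / 2) * u * gtail u) ^+ 2.
  by rewrite lerXn2r ?nnegrE ?mulr_ge0 ?expR_ge0 ?gtail_ge0 ?(ltW u0) ?(ltW pk).
have e1 : (normal_peak 1 * expR (- u ^+ 2 / 2)) ^+ 2 = normal_peak 1 ^+ 2 * expR (- u ^+ 2).
  by rewrite exprMn -expRM_natl; congr (_ * expR _); field.
have e2 : (expR (3 / 2) * u * gtail u) ^+ 2 = expR 3 * u ^+ 2 * gtail u ^+ 2.
  by rewrite !exprMn -expRM_natl; congr (expR _ * _ * _); field.
rewrite e1 e2 in h2.
have e3 : expR (- (u ^+ 2 / (1 + r))) = expR (- u ^+ 2) * expR (u ^+ 2 * r / (1 + r)).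
  rewrite -expRD; congr expR; field; lra.
rewrite e3.
have p2 : 0 < @normal_peak R 1 ^+ 2 by rewrite exprn_gt0.
have h3 : expR (- u ^+ 2) <= expR 3 / normal_peak 1 ^+ 2 * u ^+ 2 * gtail u ^+ 2.
  rewrite -(ler_pM2l p2); apply: le_trans h2 _.
  rewrite le_eqVlt; apply/orP; left; apply/eqP; field; exact: lt0r_neq0.
rewrite [leRHS]mulrAC ler_wpM2r ?expR_ge0 //.
Qed.
End CorrelatedTail.

(** * Exponential bounds on binomial coefficients *)

Section Binomial.
Context {R : realType}.
Implicit Types n k : nat.

Lemma bin_exp_le (x y : R) n k : (k <= n)%N -> 0 <= x -> 0 <= y ->
  'C(n, k)%:R * (x ^+ (n - k) * y ^+ k) <= (x + y) ^+ n.
Proof.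
move=> kn x0 y0; rewrite exprDn (bigD1 (Ordinal (kn : k < n.+1)%N)) //=.
rewrite [leLHS]mulr_natl lerDl sumr_ge0 // => i _.
by rewrite mulrn_wge0 // mulr_ge0 // exprn_ge0.
Qed.

Lemma expR_sum_le (l : R) : `|l| <= 1 / 2 ->
  expR l + expR (- l) <= 2 * expR (2 * l ^+ 2).
Proof.
rewrite ler_norml => /andP[l1 l2].
have h (x : R) : x < 1 -> expR x <= (1 - x)^-1.
  move=> x1; rewrite -[expR x]invrK -expRN lef_pV2 ?posrE ?expR_gt0 //.
    exact: expR_ge1Dx.
  lra.
have h1 := h l; have h2 := h (- l); have h3 := expR_ge1Dx (2 * l ^+ 2).
apply: (@le_trans _ _ (2 / (1 - l ^+ 2))).
  have -> : 2 / (1 - l ^+ 2) = (1 - l)^-1 + (1 - - l)^-1.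
    field; apply/and3P; split; nra.
  by apply: lerD; [apply: h1|apply: h2]; lra.
have y4 : l ^+ 2 <= 1 / 4 by nra.
have y0 : 0 <= l ^+ 2 by exact: sqr_ge0.
rewrite ler_wpM2l // -[leLHS]mul1r ler_pdivrMr; last lra.
apply: (@le_trans _ _ ((1 + 2 * l ^+ 2) * (1 - l ^+ 2))).
  have y2 : 0 <= 1 - 2 * l ^+ 2 by lra.
  have := mulr_ge0 y0 y2; lra.
by rewrite ler_wpM2r //; lra.
Qed.

(** Chernoff bound with parameter [x / 4], where [x = 1 - 2 k / n]. *)
Lemma bin_hoeffding n k (x : R) : (k <= n)%N -> `|x| <= 1 ->
  n%:R - 2 * k%:R = n%:R * x ->
  'C(n, k)%:R / 2 ^+ n <= expR (- (n%:R * x ^+ 2) / 8).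
Proof.
move=> kn x1 nx.
have x4 : `|x / 4| <= 1 / 2.
  by rewrite normrM [X in _ * X]ger0_norm ?invr_ge0 //; lra.
have h := @bin_exp_le (expR (x / 4)) (expR (- (x / 4))) n k kn (expR_ge0 _) (expR_ge0 _).
have h2 : (expR (x / 4) + expR (- (x / 4))) ^+ n <= 2 ^+ n * expR (n%:R * (x ^+ 2 / 8)).
  apply: (@le_trans _ _ ((2 * expR (2 * (x / 4) ^+ 2)) ^+ n)).
    by rewrite lerXn2r ?nnegrE ?addr_ge0 ?mulr_ge0 ?expR_ge0 // expR_sum_le.
  rewrite exprMn -expRM_natl ler_wpM2l ?exprn_ge0 // ler_expR le_eqVlt.
  by apply/orP; left; apply/eqP; field.
have := le_trans h h2.
have -> : expR (x / 4) ^+ (n - k) * expR (- (x / 4)) ^+ k = expR (n%:R * (x ^+ 2 / 4)).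
  rewrite -!expRM_natl -expRD natrB //; congr expR.
  have -> : n%:R * (x ^+ 2 / 4) = (n%:R * x) * (x / 4) by field.
  by rewrite -nx; ring.
move=> h3; rewrite ler_pdivrMr ?exprn_gt0 // -(ler_pM2r (expR_gt0 (n%:R * (x ^+ 2 / 4)))).
apply: le_trans h3 _; rewrite [leRHS]mulrAC -expRD [leLHS]mulrC ler_wpM2r ?exprn_ge0 //.
by rewrite ler_expR le_eqVlt; apply/orP; left; apply/eqP; field.
Qed.

(** Near the two ends of a row, binomial coefficients grow at an arbitrarily small
    exponential rate. *)
Lemma bin_entropy (eta : R) : 0 < eta ->
  exists2 kap : R, 0 < kap <= 1 / 2 & forall n k, (k <= n)%N ->
    k%:R <= kap * n%:R \/ (n - k)%:R <= kap * n%:R ->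
    'C(n, k)%:R <= expR (eta * n%:R).
Proof.
move=> eta0.
(* Chernoff bound ['C(n, k) <= (1 + z) ^ n z ^ - k] with [z = exp (- l)],
   [l = 2 / eta]: then [z <= eta / 2], and [l * k <= eta / 2 * n] as soon as
   [k <= eta ^ 2 / 4 * n]. *)
pose kap := Num.min (eta ^+ 2 / 4) (1 / 2).
have kap0 : 0 < kap by rewrite lt_min !divr_gt0 ?exprn_gt0.
exists kap; first by rewrite kap0 /= ge_min lexx orbT.
have main n k : (k <= n)%N -> k%:R <= kap * n%:R -> 'C(n, k)%:R <= expR (eta * n%:R).
  move=> kn kk.
  pose l := 2 / eta; have l0 : 0 < l by rewrite divr_gt0.
  have zle : expR (- l) <= eta / 2.
    rewrite expRN -[leRHS]invrK lef_pV2 ?posrE ?expR_gt0 ?invr_gt0 ?divr_gt0 //.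
    rewrite invf_div; apply: le_trans (expR_ge1Dx _); rewrite -/l; lra.
  have := @bin_exp_le 1 (expR (- l)) n k kn ler01 (expR_ge0 _).
  rewrite expr1n mul1r -expRM_natl => h.
  rewrite -(ler_pM2r (expR_gt0 (k%:R * (- l)))); apply: le_trans h _.
  apply: (@le_trans _ _ (expR (eta / 2) ^+ n)).
    rewrite lerXn2r ?nnegrE ?addr_ge0 ?expR_ge0 //.
    by apply: le_trans (expR_ge1Dx _); rewrite lerD2l.
  rewrite -expRM_natl -expRD ler_expR.
  have kl : k%:R * l <= eta / 2 * n%:R.
    apply: (@le_trans _ _ (eta ^+ 2 / 4 * n%:R * l)).
      rewrite ler_wpM2r ?(ltW l0) //; apply: le_trans kk _.
      by rewrite ler_wpM2r // ge_min lexx.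
    rewrite le_eqVlt; apply/orP; left; apply/eqP; rewrite /l; field; exact: lt0r_neq0.
  lra.
move=> n k kn [] h; first exact: main.
by rewrite -bin_sub //; apply: main => //; exact: leq_subr.
Qed.

Lemma expRN_le_pow6 (y : R) : 0 < y -> expR (- y) <= (6 / y) ^+ 6.
Proof.
move=> y0; rewrite expRN -[leRHS]invrK lef_pV2 ?posrE ?expR_gt0 ?invr_gt0 ?exprn_gt0 ?divr_gt0 //.
rewrite -exprVn invf_div.
have -> : expR y = expR (y / 6) ^+ 6 by rewrite -expRM_natl; congr expR; field.
rewrite lerXn2r ?nnegrE ?expR_ge0 ?divr_ge0 ?(ltW y0) //.
by apply: le_trans (expR_ge1Dx _); rewrite lerDr.
Qed.
End Binomial.

(** * The normalized second moment *)

Section MomentRatio.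
Context {R : realType}.
Variable eps : R.
Hypotheses (eps_gt0 : 0 < eps) (eps_lt1 : eps < 1).

(** The level in the definition of [superlevel]. *)
Definition threshold : R := (1 - eps) * Num.sqrt (2 * ln 2).

Let ln2_gt0 : 0 < ln (2 : R).
Proof. by rewrite ln_gt0 // ltr1n. Qed.

Let ln2_le1 : ln (2 : R) <= 1.
Proof. by rewrite -[leRHS]expRK ler_ln ?posrE ?expR_gt0 //; have := expR_ge1Dx (1 : R); lra. Qed.

Lemma threshold_gt0 : 0 < threshold.
Proof. by rewrite mulr_gt0 ?sqrtr_gt0 ?mulr_gt0 // subr_gt0. Qed.

Let threshold_sqr : threshold ^+ 2 = (1 - eps) ^+ 2 * (2 * ln 2).
Proof. by rewrite exprMn sqr_sqrtr // mulr_ge0 // ltW. Qed.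

Let threshold_sqr_le2 : threshold ^+ 2 <= 2.
Proof.
have h1 := eps_gt0; have h2 := eps_lt1; have l1 := ln2_le1; have l0 := ln2_gt0.
have e1 : (1 - eps) ^+ 2 <= 1 by rewrite expr_le1 //; lra.
rewrite threshold_sqr; apply: (@le_trans _ _ (1 * (2 * 1))); last lra.
apply: ler_pM => //; [exact: sqr_ge0|lra|lra].
Qed.

Let threshold_sqr_half : threshold ^+ 2 / 2 <= (1 - eps) * ln 2.
Proof.
have h1 := eps_gt0; have h2 := eps_lt1.
have e1 : (1 - eps) ^+ 2 <= 1 - eps by nra.
have := ler_wpM2r (ltW ln2_gt0) e1; rewrite threshold_sqr; lra.
Qed.

(** The overlap of two configurations of length [n] at Hamming distance [k]. *)
Definition overlap (n k : nat) : R := 1 - 2 * (k%:R / n%:R).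

(** The probability that two configurations at distance [k] both exceed the
    threshold, divided by its value for independent energies. *)
Definition pair_ratio (p n k : nat) : R :=
  qtail (overlap n k ^+ p) (threshold * Num.sqrt n%:R) /
  gtail (threshold * Num.sqrt n%:R) ^+ 2.

(** The second moment divided by the square of the first one: the average of
    [pair_ratio] over a pair of uniform configurations. *)
Definition moment_ratio (p n : nat) : R :=
  \sum_(k < n.+1) 'C(n, k)%:R / 2 ^+ n * pair_ratio p n k.

Lemma overlap_norm_le1 n k : (0 < n)%N -> (k <= n)%N -> `|overlap n k| <= 1.
Proof.
move=> n0 kn; rewrite /overlap ler_norml.
have n0' : 0 < n%:R :> R by rewrite ltr0n.
have h1 : k%:R / n%:R <= 1 :> R by rewrite ler_pdivrMr // mul1r ler_nat.
have h2 : 0 <= k%:R / n%:R :> R by rewrite divr_ge0.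
apply/andP; split; lra.
Qed.

Let norm_pow_bounds (x : R) p : `|x| <= 1 -> -1 <= x ^+ p /\ x ^+ p <= `|x| ^+ p.
Proof.
move=> x1; have : `|x ^+ p| <= 1 by rewrite normrX exprn_ile1.
by rewrite ler_norml -normrX => /andP[-> _]; split => //; exact: ler_norm.
Qed.

Let near_const : R := expR (5 / 2).

(** Almost uncorrelated pairs. *)
Let near_bound n p x : (2 <= n)%N -> (8 <= p)%N -> `|x| <= 1 -> 1 <= threshold * Num.sqrt n%:R ->
  x ^+ 4 <= n%:R^-1 ->
  qtail (x ^+ p) (threshold * Num.sqrt n%:R) <=
  (1 + 4 * n%:R^-1) * (1 + 2 * near_const * n%:R^-1) ^+ 2 * gtail (threshold * Num.sqrt n%:R) ^+ 2.
Proof.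
move=> n2 p8 x1 u1 x4; set u := threshold * _ in u1 *.
have n0 : 0 < n%:R :> R by rewrite ltr0n (leq_trans _ n2).
have in0 : 0 < n%:R^-1 :> R by rewrite invr_gt0.
have in2 : n%:R^-1 <= 1 / 2 :> R.
  by rewrite div1r lef_pV2 ?posrE // ler_nat.
have C0 : 0 < near_const by exact: expR_gt0.
have [h1 h2] := norm_pow_bounds p x1.
have u2 : u ^+ 2 <= 2 * n%:R.
  by rewrite exprMn sqr_sqrtr ?ler0n // ler_wpM2r.
have rho8 : `|x| ^+ p <= n%:R^-1 ^+ 2.
  apply: (@le_trans _ _ (`|x| ^+ 8)); first by rewrite ler_wiXn2l.
  rewrite -[8%N]/(4 * 2)%N exprM lerXn2r ?nnegrE ?exprn_ge0 ?(ltW in0) //.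
  by rewrite -normrX ger0_norm // exprn_even_ge0.
have rho_le : x ^+ p <= n%:R^-1 ^+ 2 by exact: le_trans rho8.
have [rho0|/ltW rho0] := leP (x ^+ p) 0.
  apply: le_trans (qtail_neg _ _ _) _ => //; first exact: lt_le_trans u1.
  rewrite ler_peMl ?sqr_ge0 //.
  have e1 : 1 <= 1 + 4 * n%:R^-1 :> R by lra.
  have e2 : 1 <= (1 + 2 * near_const * n%:R^-1) ^+ 2.
    by rewrite exprn_ege1 // lerDl !mulr_ge0 // ltW.
  by rewrite -[leLHS]mulr1 ler_pM.
have n_sqr : n%:R^-1 ^+ 2 <= n%:R^-1 :> R by nra.
apply: le_trans (qtail_near _ _ _) _ => //; first lra.
rewrite exprMn mulrA ler_wpM2r ?sqr_ge0 //.
have ur : u ^+ 2 * x ^+ p <= 2 * n%:R^-1.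
  apply: (@le_trans _ _ (2 * n%:R * n%:R^-1 ^+ 2)); first by rewrite ler_pM ?sqr_ge0.
  by rewrite le_eqVlt; apply/orP; left; apply/eqP; field; exact: lt0r_neq0.
have ur0 : 0 <= u ^+ 2 * x ^+ p by rewrite mulr_ge0 ?sqr_ge0.
have eC : expR (u ^+ 2 * x ^+ p / 2 + 3 / 2) <= near_const by rewrite ler_expR; lra.
apply: ler_pM.
- by rewrite addr_ge0 // mulr_ge0.
- exact: sqr_ge0.
- by rewrite lerD2l ler_wpM2l //; lra.
have le1 : 1 + u ^+ 2 * x ^+ p * expR (u ^+ 2 * x ^+ p / 2 + 3 / 2) <=
    1 + 2 * near_const * n%:R^-1.
  rewrite lerD2l [leRHS]mulrAC; apply: ler_pM => //.
have ge0 : 0 <= 1 + u ^+ 2 * x ^+ p * expR (u ^+ 2 * x ^+ p / 2 + 3 / 2).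
  by apply: addr_ge0 => //; apply: mulr_ge0 => //; exact: expR_ge0.
by rewrite lerXn2r // nnegrE // (le_trans ge0).
Qed.

Let far_const : R := expR 3 / normal_peak 1 ^+ 2.

Let far_const_gt0 : 0 < far_const.
Proof. by rewrite divr_gt0 ?expR_gt0 // exprn_gt0 // normal_peak_gt0 ?oner_neq0. Qed.

(** Comparison of the exponent of [qtail_far] with the binomial weight.  Here
    [R0] separates moderate from extreme overlaps. *)
Let far_exponent (R0 x : R) n k p : (0 < n)%N -> (k <= n)%N ->
  n%:R - 2 * k%:R = n%:R * x -> `|x| <= 1 -> 0 <= R0 -> R0 ^+ (p - 2) <= 1 / 32 ->
  (2 <= p)%N ->
  (R0 <= `|x| -> 'C(n, k)%:R <= expR (eps * ln 2 / 2 * n%:R)) ->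
  'C(n, k)%:R / 2 ^+ n *
    expR ((threshold * Num.sqrt n%:R) ^+ 2 * `|x| ^+ p / (1 + `|x| ^+ p)) <=
  expR (- (n%:R * x ^+ 2 / 16)) + expR (- (eps * ln 2 / 2 * n%:R)).
Proof.
move=> n0 kn nx x1 R00 R0p p2 ent.
have n0' : 0 < n%:R :> R by rewrite ltr0n.
have u2 : (threshold * Num.sqrt n%:R) ^+ 2 = threshold ^+ 2 * n%:R.
  by rewrite exprMn sqr_sqrtr ?ler0n.
set r := `|x| ^+ p; have r0 : 0 <= r by rewrite exprn_ge0.
have r1 : r <= 1 by rewrite exprn_ile1.
have [xR|/ltW xR] := leP `|x| R0.
  apply: (@le_trans _ _ (expR (- (n%:R * x ^+ 2 / 16)))); last by rewrite lerDl expR_ge0.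
  apply: (@le_trans _ _ (expR (- (n%:R * x ^+ 2) / 8) * expR (n%:R * x ^+ 2 / 16))); last first.
    by rewrite -expRD ler_expR le_eqVlt; apply/orP; left; apply/eqP; field.
  apply: ler_pM; rewrite ?divr_ge0 ?exprn_ge0 ?expR_ge0 //; first exact: bin_hoeffding.
  rewrite ler_expR ler_pdivrMr; last lra.
  have rx : r <= x ^+ 2 / 32.
    rewrite /r -(subnKC p2) exprD -normrX ger0_norm ?sqr_ge0 // ler_wpM2l ?sqr_ge0 //.
    rewrite -[leRHS]div1r; apply: le_trans R0p.
    by rewrite lerXn2r ?nnegrE.
  apply: (@le_trans _ _ (2 * n%:R * r)).
    by rewrite u2 ler_wpM2r // ler_wpM2r // ltW.
  have := ler_wpM2l (ltW n0') rx.
  have : 0 <= n%:R * x ^+ 2 / 16 * r by rewrite mulr_ge0 // divr_ge0 // mulr_ge0 ?sqr_ge0.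
  lra.
apply: (@le_trans _ _ (expR (- (eps * ln 2 / 2 * n%:R)))); last by rewrite lerDr expR_ge0.
have two_n : (2 : R) ^+ n = expR (n%:R * ln 2) by rewrite expRM_natl lnK ?posrE.
rewrite two_n -expRN.
apply: (@le_trans _ _ (expR (eps * ln 2 / 2 * n%:R) * expR (- (n%:R * ln 2)) *
    expR ((1 - eps) * ln 2 * n%:R))).
  apply: ler_pM; rewrite ?mulr_ge0 ?expR_ge0 //.
    by rewrite ler_wpM2r ?expR_ge0 //; exact: ent.
  rewrite ler_expR u2.
  apply: (@le_trans _ _ (threshold ^+ 2 / 2 * n%:R)); last by rewrite ler_wpM2r // ltW.
  rewrite ler_pdivrMr; last lra.
  have t0 : 0 <= threshold ^+ 2 * n%:R by rewrite mulr_ge0 ?sqr_ge0 // ltW.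
  nra.
by rewrite -!expRD ler_expR le_eqVlt; apply/orP; left; apply/eqP; field.
Qed.

(** The constants come from [exp (- y) <= (6 / y) ^ 6], with [y = n x ^ 2 / 16]
    or [y = eps ln 2 / 2 * n], and from [n x ^ 4 >= 1]. *)
Let far_bound n p k x (R0 : R) : (0 < n)%N -> (k <= n)%N ->
  n%:R - 2 * k%:R = n%:R * x -> `|x| <= 1 -> 0 <= R0 -> R0 ^+ (p - 2) <= 1 / 32 ->
  (2 <= p)%N -> 1 <= threshold * Num.sqrt n%:R -> n%:R^-1 <= x ^+ 4 ->
  (R0 <= `|x| -> 'C(n, k)%:R <= expR (eps * ln 2 / 2 * n%:R)) ->
  'C(n, k)%:R / 2 ^+ n * qtail (x ^+ p) (threshold * Num.sqrt n%:R) <=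
  2 * far_const * (96 ^+ 6 + (12 / (eps * ln 2)) ^+ 6) / n%:R ^+ 2 *
  gtail (threshold * Num.sqrt n%:R) ^+ 2.
Proof.
move=> n0 kn nx x1 R00 R0p p2 u1 x4 ent.
have n0' : 0 < n%:R :> R by rewrite ltr0n.
have n1 : 1 <= n%:R :> R by rewrite ler1n.
have := far_exponent n0 kn nx x1 R00 R0p p2 ent.
set u := threshold * _ in u1 *; set w := _ / 2 ^+ n.
have w0 : 0 <= w by rewrite divr_ge0 ?exprn_ge0.
have u2 : u ^+ 2 <= 2 * n%:R.
  by rewrite exprMn sqr_sqrtr ?ler0n // ler_wpM2r.
have [h1 h2] := norm_pow_bounds p x1.
set r := `|x| ^+ p in h2 *; have r0 : 0 <= r by rewrite exprn_ge0.
have q := qtail_far h1 h2 r0 u1.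
move=> we.
apply: le_trans (ler_wpM2l w0 q) _.
rewrite -/far_const mulrA ler_wpM2r ?sqr_ge0 //.
set c := eps * ln 2 / 2 in we.
have c0 : 0 < c by rewrite divr_gt0 // mulr_gt0.
set E := expR _ in we *.
have -> : w * (far_const * u ^+ 2 * E) = far_const * u ^+ 2 * (w * E) by ring.
apply: (@le_trans _ _ (far_const * (2 * n%:R) * ((96 ^+ 6 + (12 / (eps * ln 2)) ^+ 6) / n%:R ^+ 3))); last first.
  by rewrite le_eqVlt; apply/orP; left; apply/eqP; field; rewrite !lt0r_neq0.
have wE0 : 0 <= w * E by rewrite mulr_ge0 ?expR_ge0.
apply: ler_pM => //; first by rewrite mulr_ge0 ?sqr_ge0 ?(ltW far_const_gt0).
  by rewrite ler_wpM2l ?(ltW far_const_gt0).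
apply: (le_trans we); rewrite mulrDl.
have x20 : 0 < x ^+ 2.
  rewrite lt0r sqr_ge0 andbT; apply/eqP => x20.
  move: x4; rewrite -[4%N]/(2 * 2)%N exprM x20 expr0n /= leNgt invr_gt0 n0' //.
apply: lerD.
  apply: le_trans (expRN_le_pow6 _) _; first by rewrite divr_gt0 // mulr_gt0.
  have -> : 6 / (n%:R * x ^+ 2 / 16) = 96 * (n%:R * x ^+ 2)^-1.
    have xn0 : x != 0 by apply: contraTneq x20 => ->; rewrite expr0n ltxx.
    by field; rewrite xn0 lt0r_neq0.
  have nx2 : 0 < n%:R * x ^+ 2 by rewrite mulr_gt0.
  rewrite exprMn ler_wpM2l ?exprn_ge0 // exprVn lef_pV2 ?posrE ?(exprn_gt0 _ nx2) ?exprn_gt0 //.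
  have -> : (n%:R * x ^+ 2) ^+ 6 = n%:R ^+ 3 * (n%:R * x ^+ 4) ^+ 3 by ring.
  rewrite ler_peMr ?exprn_ge0 // exprn_ege1 //.
  by rewrite -ler_pdivrMl // mulr1.
apply: le_trans (expRN_le_pow6 _) _; first by rewrite mulr_gt0.
have -> : 6 / (c * n%:R) = 12 / (eps * ln 2) * n%:R^-1.
  by rewrite /c; field; rewrite !lt0r_neq0.
rewrite exprMn ler_wpM2l ?exprn_ge0 ?divr_ge0 ?mulr_ge0 ?(ltW eps_gt0) ?(ltW ln2_gt0) //.
rewrite exprVn lef_pV2 ?posrE ?exprn_gt0 //.
by rewrite ler_weXn2l.
Qed.

Lemma moment_ratio_le : exists p0 : nat, forall p, (p0 <= p)%N ->
  exists (K : R) (n0 : nat), forall n, (n0 <= n)%N -> (0 < n)%N ->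
    moment_ratio p n <= 1 + K / n%:R.
Proof.
have eta0 : 0 < eps * ln 2 / 2 by rewrite divr_gt0 // mulr_gt0.
have [kap /andP[kap0 kap12] ent] := bin_entropy eta0.
pose R0 := 1 - 2 * kap.
have R00 : 0 <= R0 by rewrite /R0; lra.
have R01 : R0 < 1 by rewrite /R0; lra.
have [m R0m] : exists m, R0 ^+ m <= 1 / 32.
  have /cvgrPdist_lt/(_ (1 / 32)) : R0 ^+ n @[n --> \oo] --> (0 : R).
    by apply: cvg_expr; rewrite ger0_norm.
  have e32 : 0 < 1 / 32 :> R by lra.
  move=> /(_ e32) [m _ /(_ m (leqnn m))] /=.
  by rewrite sub0r normrN => h; exists m; apply: le_trans (ler_norm _) (ltW h).
exists (maxn 8 m.+2) => p; rewrite geq_max => /andP[p8 pm].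
have p2 : (2 <= p)%N by exact: leq_trans p8.
have R0p : R0 ^+ (p - 2) <= 1 / 32.
  apply: le_trans R0m; apply: ler_wiXn2l => //; first exact: ltW.
  by rewrite leq_subRL // add2n.
pose K1 : R := 4 + (4 * near_const + 4 * near_const ^+ 2) * 5.
pose K2 : R := 2 * far_const * (96 ^+ 6 + (12 / (eps * ln 2)) ^+ 6).
exists (K1 + 2 * K2).
have t0 := threshold_gt0.
have [n1 n1P] : exists n1 : nat, threshold ^- 2 <= n1%:R.
  exists (Num.truncn (threshold ^- 2)).+1; apply: ltW.
  exact: truncnS_gt.
exists (maxn 2 n1) => n; rewrite geq_max => /andP[n2 nn1] n0.
have n0' : 0 < n%:R :> R by rewrite ltr0n.
have u1 : 1 <= threshold * Num.sqrt n%:R.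
  have tn0 : 0 <= threshold * Num.sqrt n%:R.
    by apply: mulr_ge0; [exact: ltW|exact: sqrtr_ge0].
  rewrite -(@ler_pXn2r _ 2) ?nnegrE //.
  rewrite expr1n exprMn sqr_sqrtr ?ler0n // -ler_pdivrMl ?exprn_gt0 // mulr1.
  by apply: (le_trans n1P); rewrite ler_nat.
have g0 : 0 < gtail (threshold * Num.sqrt n%:R).
  by apply: gtail_gt0; exact: (le_trans ler01 u1).
have C0 : 0 < near_const by exact: expR_gt0.
have in0 : 0 < n%:R^-1 :> R by rewrite invr_gt0.
have in1 : n%:R^-1 <= 1 :> R by rewrite invf_le1 // ler1n.
pose a : R := (1 + 4 * n%:R^-1) * (1 + 2 * near_const * n%:R^-1) ^+ 2.
have a0 : 0 <= a.
  by rewrite mulr_ge0 ?sqr_ge0 // addr_ge0 // mulr_ge0 // ltW.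
have K20 : 0 <= K2.
  apply: mulr_ge0; first by rewrite mulr_ge0 // ltW.
  apply: addr_ge0; apply: exprn_ge0 => //.
  by rewrite divr_ge0 // mulr_ge0 // ltW.
have term (k : 'I_n.+1) : 'C(n, k)%:R / 2 ^+ n * pair_ratio p n k <=
    'C(n, k)%:R / 2 ^+ n * a + K2 / n%:R ^+ 2.
  have kn : (k <= n)%N by rewrite -ltnS.
  have x1 := overlap_norm_le1 n0 kn.
  have w0 : 0 <= 'C(n, k)%:R / 2 ^+ n :> R by rewrite divr_ge0 ?exprn_ge0.
  have nx : n%:R - 2 * k%:R = n%:R * overlap n k.
    by rewrite /overlap; field; exact: lt0r_neq0.
  rewrite /pair_ratio mulrA ler_pdivrMr ?exprn_gt0 //.
  have [x4|/ltW x4] := leP (overlap n k ^+ 4) n%:R^-1.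
    apply: le_trans (ler_wpM2l w0 (near_bound n2 p8 x1 u1 x4)) _.
    rewrite mulrA ler_wpM2r ?sqr_ge0 // -/a lerDl divr_ge0 ?exprn_ge0 //.
  apply: le_trans (far_bound n0 kn nx x1 R00 R0p p2 u1 x4 _) _; last first.
    by rewrite -/K2 ler_wpM2r ?sqr_ge0 // lerDr mulr_ge0.
  move=> hx; apply: ent => //.
  have k_eq : k%:R = n%:R * (1 - overlap n k) / 2 by rewrite mulrBr -nx; field.
  rewrite natrB // k_eq.
  have [h0|h0] := leP 0 (overlap n k).
    left; move: hx; rewrite ger0_norm // /R0 => hx; nra.
  right; move: hx; rewrite ltr0_norm // /R0 => hx; nra.
(* The weights sum to 1, and the [n + 1] error terms to [2 * K2 / n] at most. *)
apply: (@le_trans _ _ (\sum_(k < n.+1) ('C(n, k)%:R / 2 ^+ n * a + K2 / n%:R ^+ 2))).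
  by apply: ler_sum => k _; exact: term.
rewrite big_split /= sumr_const card_ord -mulr_suml.
have -> : \sum_(k < n.+1) 'C(n, k)%:R / 2 ^+ n = 1 :> R.
  rewrite -mulr_suml -natr_sum.
  have -> : (\sum_(k < n.+1) 'C(n, k) = 2 ^ n)%N.
    rewrite -[2%N]/(1 + 1)%N expnDn; apply: eq_bigr => k _.
    by rewrite !exp1n !muln1.
  by rewrite natrX divff // expf_neq0.
rewrite mul1r mulrDl addrA; apply: lerD.
  rewrite /a /K1; set x := n%:R^-1 in in0 in1 *.
  have h1 : (1 + 2 * near_const * x) ^+ 2 <= 1 + (4 * near_const + 4 * near_const ^+ 2) * x.
    have : near_const ^+ 2 * x ^+ 2 <= near_const ^+ 2 * x.
      by rewrite ler_wpM2l ?sqr_ge0 //; nra.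
    lra.
  set B := 4 * near_const + _ in h1 *.
  have B0 : 0 <= B by rewrite addr_ge0 // mulr_ge0 ?sqr_ge0 // ltW.
  apply: (@le_trans _ _ ((1 + 4 * x) * (1 + B * x))).
    by rewrite ler_wpM2l //; lra.
  have : B * x ^+ 2 <= B * x by rewrite ler_wpM2l //; nra.
  lra.
rewrite -[leLHS]mulr_natr.
apply: (@le_trans _ _ (K2 / n%:R ^+ 2 * (2 * n%:R))).
  apply: ler_wpM2l; first by rewrite divr_ge0 ?exprn_ge0.
  by rewrite -natrM ler_nat mul2n -addnn -addn1 leq_add2l.
by rewrite le_eqVlt; apply/orP; left; apply/eqP; field; exact: lt0r_neq0.
Qed.
End MomentRatio.

(** * Counting pairs of configurations by Hamming distance *)

Section Counting.
Context {R : realType}.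

Lemma sum_tuple_prod (n p : nat) (f : 'I_n -> R) :
  \sum_(t : p.-tuple 'I_n) \prod_(k < p) f (tnth t k) = (\sum_(j < n) f j) ^+ p.
Proof.
transitivity (\prod_(k < p) \sum_(j < n) f j); last by rewrite prodr_const card_ord.
rewrite bigA_distr_bigA /=.
rewrite (reindex (fun g : {ffun 'I_p -> 'I_n} => [tuple g k | k < p])) /=.
  by apply: eq_bigr => g _; apply: eq_bigr => k _; rewrite tnth_mktuple.
exists (fun t : p.-tuple 'I_n => [ffun k => tnth t k]) => [g _|t _].
  by apply/ffunP => k; rewrite ffunE tnth_mktuple.
by apply: eq_from_tnth => k; rewrite tnth_mktuple ffunE.
Qed.

(** The Hamming distance. *)
Definition hamming n (s t : Sigma n) : nat := #|[set i | s i != t i]|%SET.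

Lemma hamming_id n (s : Sigma n) : hamming s s = 0%N.
Proof. by apply/eqP; rewrite cards_eq0; apply/eqP/finset.setP => i; rewrite !inE eqxx. Qed.

Lemma sum_hamming n (F : nat -> R) (s : Sigma n) :
  \sum_(t : Sigma n) F (hamming s t) = \sum_(k < n.+1) 'C(n, k)%:R * F k.
Proof.
transitivity (\sum_(A : {set 'I_n}) F #|A|).
  rewrite (reindex (fun A : {set 'I_n} => [ffun i => s i (+) (i \in A)] : Sigma n)) /=.
    apply: eq_bigr => A _; congr (F _); rewrite /hamming; apply: eq_card => i.
    by rewrite !inE ffunE; case: (s i); case: (i \in A).
  exists (fun t : Sigma n => [set i | s i != t i]%SET) => [A _|t _].
    by apply/finset.setP => i; rewrite !inE ffunE; case: (s i); case: (i \in A).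
  by apply/ffunP => i; rewrite ffunE !inE; case: (s i); case: (t i).
have cA (A : {set 'I_n}) : (#|A| < n.+1)%N by rewrite ltnS -[leqRHS]card_ord max_card.
rewrite (partition_big (fun A : {set 'I_n} => Ordinal (cA A)) predT) //=.
apply: eq_bigr => k _.
rewrite (eq_bigr (fun _ => F k)); last by move=> A /eqP <-.
rewrite sumr_const -[LHS]mulr_natl; congr (_%:R * _).
rewrite -[X in 'C(X, _)]card_ord -card_draws -cardsE; apply: eq_card => A.
by rewrite !inE.
Qed.

Lemma spin_mul_sum n (s t : Sigma n) : (0 < n)%N ->
  \sum_(i < n) spin R s i * spin R t i = n%:R * overlap n (hamming s t).
Proof.
move=> n0.
rewrite (eq_bigr (fun i => 1 - 2 * (s i != t i)%:R)); last first.
  by move=> i _; rewrite /spin; case: (s i); case: (t i); rewrite /= ?expr0 ?expr1; ring.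
rewrite sumrB sumr_const card_ord -mulr_sumr -natr_sum /overlap.
have -> : (\sum_(i < n) (s i != t i))%N = hamming s t.
  rewrite /hamming -sum1_card [RHS]big_mkcond /=; apply: eq_bigr => i _.
  by rewrite inE; case: (s i != t i).
by field; rewrite pnatr_eq0 -lt0n.
Qed.
End Counting.

(** * Moments of a sum of indicators *)

Section SecondMoment.
Context {R : realType} {d : measure_display} {T : measurableType d}.
Variable P : probability T R.

(** Jensen's inequality for the square, by integrating [2 e X <= X ^ 2 + e ^ 2];
    [X ^ 2] need not be integrable. *)
Lemma expectation_sqr_ge (X : T -> R) (e : R) :
  measurable_fun setT X -> (forall w, 0 <= X w) ->
  ('E_P[X] = e%:E)%E -> ((e ^+ 2)%:E <= 'E_P[fun w => (X w ^+ 2)%R])%E.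
Proof.
move=> mX X0; rewrite unlock => EX.
have e0 : 0 <= e by rewrite -lee_fin -EX integral_ge0 // => w _; rewrite lee_fin.
have mX2 : measurable_fun setT (fun w => X w ^+ 2) by exact: measurable_funX.
have h : (\int[P]_w ((2 * e)%:E * (X w)%:E) <=
    \int[P]_w ((X w ^+ 2)%:E + (e ^+ 2)%:E))%E.
  apply: ge0_le_integral => //.
  - by move=> w _; rewrite lee_fin !mulr_ge0.
  - by apply: emeasurable_funM => //; apply/measurable_EFinP.
  - by apply: emeasurable_funD => //; apply/measurable_EFinP.
  - move=> w _; rewrite -EFinM -EFinD lee_fin.
    have := sqr_ge0 (X w - e); rewrite sqrrB; lra.
move: h; rewrite ge0_integralZl //; last 3 first.
- by apply/measurable_EFinP.
- by move=> w _; rewrite lee_fin.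
- by rewrite lee_fin mulr_ge0.
rewrite ge0_integralD //; last 3 first.
- by move=> w _; rewrite lee_fin sqr_ge0.
- by apply/measurable_EFinP.
- by move=> w _; rewrite lee_fin sqr_ge0.
rewrite EX integral_cst // [X in (_ + _ * X)%E]probability_setT mule1 -EFinM.
case: (integral _ _ _) => [r| |] //=; rewrite ?leey // -EFinD !lee_fin.
lra.
Qed.

Variables (S : finType) (E : S -> set T).
Hypothesis mE : forall s, measurable (E s).

Lemma expectation_sum_indic :
  ('E_P[fun w => (\sum_s \1_(E s) w)%R] = \sum_s P (E s))%E.
Proof.
rewrite unlock.
under eq_integral => w _ do rewrite -sumEFin.
rewrite ge0_integral_sum //.
- by apply: eq_bigr => s _; rewrite integral_indic // setIT.
- by move=> s; apply/measurable_EFinP; exact: measurable_indic.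
Qed.

Lemma expectation_sqr_sum_indic :
  ('E_P[fun w => ((\sum_s \1_(E s) w) ^+ 2)%R] =
   \sum_s \sum_s' P (E s `&` E s'))%E.
Proof.
rewrite unlock.
under eq_integral => w _ do rewrite expr2 mulr_suml -sumEFin.
rewrite ge0_integral_sum //; last 2 first.
- move=> s; apply/measurable_EFinP; apply: measurable_funM.
    exact: measurable_indic.
  by apply: measurable_sum => s'; exact: measurable_indic.
- by move=> s w _; rewrite lee_fin mulr_ge0 // sumr_ge0.
apply: eq_bigr => s _.
under eq_integral => w _ do rewrite mulr_sumr -sumEFin.
rewrite ge0_integral_sum //; last first.
  move=> s'; apply/measurable_EFinP; apply: measurable_funM; exact: measurable_indic.
apply: eq_bigr => s' _.
rewrite -[X in P X]setIT -integral_indic //; last exact: measurableI.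
by apply: eq_integral => w _; rewrite indicI.
Qed.
End SecondMoment.

(** * The joint law of two energies *)

Section PairLaw.
Context {R : realType} {d : measure_display} {T : measurableType d}.
Variables (P : probability T R) (n p : nat) (J : p.-tuple 'I_n -> {RV P >-> R}).
Hypotheses (n_gt0 : (0 < n)%N) (iidJ : iid_standard_normal J).

(** The coefficient of [J i] in the energy of [s], a sign. *)
Let spins (s : Sigma n) (i : p.-tuple 'I_n) : R := \prod_(k < p) spin R s (tnth i k).

Let spinE (s : Sigma n) i : spin R s i = 1 \/ spin R s i = -1.
Proof. by rewrite /spin; case: (s i); [right|left]. Qed.

Let spin_sqr (s : Sigma n) i : spin R s i ^+ 2 = 1.
Proof. by case: (spinE s i) => ->; rewrite ?sqrrN expr1n. Qed.

Let spins_sqr s i : spins s i ^+ 2 = 1.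
Proof. by rewrite /spins -prodrXl big1 // => k _; exact: spin_sqr. Qed.

Let spins_neq0 s i : spins s i != 0.
Proof. by rewrite -sqrf_eq0 spins_sqr oner_eq0. Qed.

Let spins_opp s t i : spins s i != spins t i -> spins t i = - spins s i.
Proof.
move=> st; have : (spins t i - spins s i) * (spins t i + spins s i) = 0.
  by rewrite -subr_sqr !spins_sqr subrr.
move/eqP; rewrite mulf_eq0 subr_eq0 [_ == spins s i]eq_sym (negbTE st) /=.
by rewrite addr_eq0 => /eqP.
Qed.

(** The indices on which the coefficients for [s] and [t] agree, and those on
    which they are opposite. *)
Let agree s t : seq (p.-tuple 'I_n) :=
  [seq i <- index_enum _ | spins s i == spins t i].

Let differ s t : seq (p.-tuple 'I_n) :=
  [seq i <- index_enum _ | spins s i != spins t i].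

(** The correlation of the two energies. *)
Let rho (s t : Sigma n) : R := overlap n (hamming s t) ^+ p.

Let sum_const_seq (c : R) (u : seq (p.-tuple 'I_n)) :
  \sum_(i <- u) c = c *+ size u.
Proof. by rewrite big_const_seq count_predT iter_addr_0. Qed.

(** The difference of the two sizes is the sum over all tuples of the products of
    spins of [s] and [t], that is the [p]-th power of the sum of the [s_j t_j]. *)
Let size_agree_differ s t :
  (size (agree s t))%:R = n%:R ^+ p * ((1 + rho s t) / 2) :> R /\
  (size (differ s t))%:R = n%:R ^+ p * ((1 - rho s t) / 2) :> R.
Proof.
have sumE : (size (agree s t))%:R + (size (differ s t))%:R = n%:R ^+ p :> R.
  rewrite -natrD /agree /differ !size_filter count_predC.
  by rewrite -sum1_size sum1_card card_tuple card_ord natrX.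
have subE : (size (agree s t))%:R - (size (differ s t))%:R = n%:R ^+ p * rho s t :> R.
  rewrite /rho -exprMn -spin_mul_sum // -sum_tuple_prod.
  rewrite (bigID (fun i => spins s i == spins t i)) /=.
  have prodE i : \prod_(k < p) (spin R s (tnth i k) * spin R t (tnth i k)) = spins s i * spins t i.
    by rewrite big_split.
  rewrite (eq_bigr (fun=> 1)); last by move=> i /eqP e; rewrite prodE -e -expr2 spins_sqr.
  rewrite [X in _ = _ + X](eq_bigr (fun=> -1)); last first.
    by move=> i /spins_opp e; rewrite prodE e mulrN -expr2 spins_sqr.
  rewrite -[X in _ = X + _]big_filter -[X in _ = _ + X]big_filter.
  by rewrite [X in _ = X + _]sum_const_seq [X in _ = _ + X]sum_const_seq mulNrn.
split; lra.
Qed.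

Let hamiltonian_agree_differ s t w :
  let k : R := n%:R `^ (- (p.+1%:R / 2)) in
  let x := linear_form J (spins s) (agree s t) w in
  let y := linear_form J (spins s) (differ s t) w in
  hamiltonian (fun i => J i w) s = k * (x + y) /\
  hamiltonian (fun i => J i w) t = k * (x - y).
Proof.
rewrite /hamiltonian /linear_form /agree /differ !big_filter /=.
rewrite !(bigID (fun i => spins s i == spins t i) predT) /=; split; congr (_ * _).
  by congr (_ + _); apply: eq_bigr => i _; rewrite mulrC.
rewrite -sumrN; congr (_ + _); apply: eq_bigr => i.
  by move=> /eqP e; rewrite mulrC -/(spins t i) -e.
by move=> /spins_opp e; rewrite mulrC -/(spins t i) e mulNr.
Qed.

(** The normalization gives each energy the variance [1 / n]. *)
Let scaleE : Num.sqrt n%:R * n%:R `^ (- (p.+1%:R / 2)) * Num.sqrt (n%:R ^+ p) = 1 :> R.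
Proof.
rewrite powRN powRrM powR_mulrn ?ler0n // powR12_sqrt ?exprn_ge0 ?ler0n //.
rewrite exprS sqrtrM ?ler0n //; field.
by rewrite !sqrtr_eq0 -!ltNge exprn_gt0 ?ltr0n.
Qed.

(** The pair of energies lies above [thr] exactly when the sums over the two
    families of indices lie in a wedge. *)
Lemma hamiltonian_pair_law (thr : R) (s t : Sigma n) :
  P ([set w | thr <= hamiltonian (fun i => J i w) s] `&`
     [set w | thr <= hamiltonian (fun i => J i w) t]) =
  (qtail (overlap n (hamming s t) ^+ p) (thr * Num.sqrt n%:R))%:E.
Proof.
set k : R := n%:R `^ (- (p.+1%:R / 2)).
have k0 : 0 < k by rewrite powR_gt0 // ltr0n.
have -> : [set w | thr <= hamiltonian (fun i => J i w) s] `&`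
    [set w | thr <= hamiltonian (fun i => J i w) t] =
    (fun w => (linear_form J (spins s) (agree s t) w,
               linear_form J (spins s) (differ s t) w)) @^-1` (wedge k k thr).
  apply/seteqP; split => w; rewrite /wedge /=;
    have [-> ->] := hamiltonian_agree_differ s t w; rewrite mulrDr mulrBr //.
rewrite (linear_forms_joint_law iidJ (spins_neq0 s)); last first.
- exact: measurable_wedge.
- rewrite cat_uniq !filter_uniq ?index_enum_uniq //= andbT.
  by apply/hasPn => i; rewrite !mem_filter => /andP[h _]; rewrite (negbTE h).
rewrite /qtail joint_tailE; congr (product_measure1 _ _ _).
have sdE (u : seq (p.-tuple 'I_n)) : form_sd (spins s) u = Num.sqrt (size u)%:R.
  rewrite /form_sd (eq_bigr (fun=> 1)); last by move=> i _; exact: spins_sqr.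
  by rewrite sum_const_seq.
have [sA sD] := size_agree_differ s t.
have sn : 0 < Num.sqrt n%:R :> R by rewrite sqrtr_gt0 ltr0n.
have coef x (m : nat) : m%:R = n%:R ^+ p * x -> Num.sqrt n%:R * (k * Num.sqrt m%:R) = Num.sqrt x.
  by move=> ->; rewrite sqrtrM ?exprn_ge0 ?ler0n // !mulrA scaleE mul1r.
rewrite /dilation2 /wedge !sdE -(coef _ _ sA) -(coef _ _ sD).
have scale_le x : (thr <= x) = (thr * Num.sqrt n%:R <= Num.sqrt n%:R * x).
  by rewrite mulrC ler_pM2l.
apply/seteqP; split => z /= [h1 h2]; split; [move: h1|move: h2|move: h1|move: h2];
  rewrite scale_le; congr (_ <= _); ring.
Qed.
End PairLaw.

(** * The two moments *)

Section Moments.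
Context {R : realType} {d : measure_display} {T : measurableType d}.
Variables (P : probability T R) (n p : nat) (J : p.-tuple 'I_n -> {RV P >-> R}).
Hypotheses (n_gt0 : (0 < n)%N) (iidJ : iid_standard_normal J).
Variable eps : R.
Hypotheses (eps_gt0 : 0 < eps) (eps_lt1 : eps < 1).

Let u : R := threshold eps * Num.sqrt n%:R.

(** The event that the energy of [s] reaches the threshold. *)
Let exceed (s : Sigma n) : set T :=
  [set w | threshold eps <= hamiltonian (fun i => J i w) s].

Let measurable_exceed s : measurable (exceed s).
Proof.
rewrite (_ : exceed s =
  (fun w => hamiltonian (fun i => J i w) s) @^-1` `[threshold eps, +oo[); last first.
  by apply/seteqP; split => w; rewrite /exceed /= in_itv /= andbT.
rewrite -[X in measurable X]setTI.
suff : measurable_fun setT (fun w => hamiltonian (fun i => J i w) s) by apply.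
apply: measurable_funM => //; apply: measurable_sum => i.
by apply: measurable_funM.
Qed.

(** The one-point tail is the joint tail of a configuration with itself. *)
Let probability_exceed s : P (exceed s) = (gtail u)%:E.
Proof.
rewrite -[exceed s]setIid (hamiltonian_pair_law n_gt0 iidJ) hamming_id.
rewrite /overlap mul0r mulr0 subr0 expr1n /qtail subrr mul0r sqrtr0.
have -> : (1 + 1) / 2 = 1 :> R by field.
rewrite sqrtr1 joint_tailE gtailE.
rewrite (_ : wedge _ _ _ = `[u, +oo[%classic `*` setT); last first.
  apply/seteqP; split => z; rewrite /wedge /= !in_itv /= !andbT !mul0r subr0 addr0 !mul1r.
    by case.
  by case.
by rewrite product_measure1E // [X in (_ * X)%E]probability_setT mule1.
Qed.

Let card_superlevel w :
  (#|superlevel eps (fun i => J i w)|%:R : R) = \sum_s \1_(exceed s) w.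
Proof.
rewrite -sum1_card natr_sum big_mkcond /=; apply: eq_bigr => s _.
rewrite inE indicE -/(threshold eps); case: ifP => h.
  by rewrite mem_set.
by rewrite memNset // /exceed /= h.
Qed.

Let card_Sigma : #|Sigma n| = (2 ^ n)%N.
Proof. by rewrite card_ffun card_bool card_ord. Qed.

Lemma expectation_superlevel :
  ('E_P[fun w => (#|superlevel eps (fun i => J i w)|%:R : R)%R] =
   (2 ^+ n * gtail u)%R%:E)%E.
Proof.
under eq_fun => w do rewrite card_superlevel.
rewrite expectation_sum_indic //.
under eq_bigr => s _ do rewrite probability_exceed.
by rewrite sumEFin sumr_const card_Sigma -[X in X%:E]mulr_natl natrX.
Qed.

Let gtail_u_gt0 : 0 < gtail u.
Proof.
by apply: gtail_gt0; rewrite mulr_ge0 ?sqrtr_ge0 // ltW // threshold_gt0.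
Qed.

Lemma expectation_superlevel_sqr :
  ('E_P[fun w => (#|superlevel eps (fun i => J i w)|%:R ^+ 2 : R)%R] =
   ((2 ^+ n * gtail u) ^+ 2 * moment_ratio eps p n)%R%:E)%E.
Proof.
under eq_fun => w do rewrite card_superlevel.
rewrite expectation_sqr_sum_indic //.
under eq_bigr => s _.
  under eq_bigr => t _ do rewrite (hamiltonian_pair_law n_gt0 iidJ).
  rewrite sumEFin (sum_hamming (fun k => qtail (overlap n k ^+ p) u)).
  over.
rewrite sumEFin sumr_const card_Sigma; congr EFin.
rewrite -[LHS]mulr_natl natrX /moment_ratio !mulr_sumr; apply: eq_bigr => k _.
rewrite /pair_ratio -/u; field.
by rewrite (gt_eqF gtail_u_gt0) expf_neq0.
Qed.

Lemma moment_ratio_ge1 : 1 <= moment_ratio eps p n.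
Proof.
have mX : measurable_fun setT
    (fun w => (#|superlevel eps (fun i => J i w)|%:R : R)).
  under eq_fun => w do rewrite card_superlevel.
  by apply: measurable_sum => s; exact: measurable_indic.
have := expectation_sqr_ge mX (fun w => ler0n _ _) expectation_superlevel.
rewrite expectation_superlevel_sqr lee_fin.
by rewrite ler_pMr // exprn_gt0 // mulr_gt0 // exprn_gt0.
Qed.
End Moments.

(** * The second moment estimate *)

Theorem proposition2p1 (R : realType) (eps : R) (heps0 : 0 < eps)
    (heps1 : eps < 1) :
  exists Peps : nat, forall p : nat, (2 <= p)%N -> (Peps <= p)%N ->
  forall (d : nat -> measure_display)
    (T : forall n : nat, measurableType (d n))
    (P : forall n : nat, probability (T n) R)
    (J : forall n : nat, p.-tuple 'I_n -> {RV (P n) >-> R}),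
  (forall n : nat, (0 < n)%N -> iid_standard_normal (@J n)) ->
  let Seps (n : nat) (w : T n) : {set Sigma n} :=
    superlevel eps (fun i => J n i w) in
  exists o : nat -> R,
    (o @ \oo --> (0 : R)) /\
    forall n : nat, (0 < n)%N ->
      ('E_(P n)[fun w => (#|Seps n w|%:R ^+ 2 : R)%R] =
       'E_(P n)[fun w => (#|Seps n w|%:R : R)%R] ^+ 2 * (1 + o n)%R%:E)%E.
Proof.
have [p0 p0P] := moment_ratio_le heps0 heps1.
exists p0 => p _ /p0P[K [n0 ratio_le]] d T P J iidJ Seps.
exists (fun n => moment_ratio eps p n - 1); split; last first.
  move=> n n_gt0; rewrite /Seps.
  rewrite (expectation_superlevel_sqr n_gt0 (iidJ n n_gt0)) //.
  rewrite (expectation_superlevel n_gt0 (iidJ n n_gt0)).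
  by rewrite -EFin_expe -EFinM; congr (_ * _)%:E; rewrite addrC subrK.
apply/cvgrPdist_le => e e0.
exists (maxn n0 (Num.truncn (K / e)).+1) => // n /=.
rewrite geq_max => /andP[nn0 nK].
have n_gt0 : (0 < n)%N by exact: leq_trans nK.
have ge1 := moment_ratio_ge1 n_gt0 (iidJ n n_gt0) heps1.
rewrite sub0r normrN ger0_norm ?subr_ge0 //.
rewrite lerBlDl; apply: le_trans (ratio_le n nn0 n_gt0) _.
rewrite lerD2l ler_pdivrMr ?ltr0n // mulrC -ler_pdivrMr //.
by apply: (le_trans (ltW (truncnS_gt _))); rewrite ler_nat.
Qed.
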